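(* Let $m\ge 3$ and let $a,b,c$ be integers with $1\le a\le b<\frac m2$ and $1\le c\le\frac m2$. Then $B_2(m;a,b,c)$ is a nut graph if and only if all of the following hold: (i) $m$ is coprime to each of $\gcd(a-b,a+b+c)$, $\gcd(a-b,a+b-c)$, $\gcd(a+b,a-b+c)$, $\gcd(a+b,a-b-c)$; (ii) if $v_2(m)>v_2(c)$, then neither $v_2(a)$ nor $v_2(b)$ equals $v_2(c)-1$; (iii) if $12\mid m$, then it is not the case that $a+b\equiv\pm2$, $a-b\equiv\pm 2$ and $c\equiv\pm3\pmod{12}$; (iv) if $30\mid m$, then none of the following holds modulo $30$: one of $a+b,a-b$ is $\equiv\pm3$, the other $\equiv\pm5$, and $c\equiv\pm6$; one of $a+b,a-b$ is $\equiv\pm3$, the other $\equiv\pm9$, and $c\equiv\pm10$; one of $a+b,a-b$ is $\equiv\pm5$, the other $\equiv\pm9$, and $c\equiv\pm12$. All $\pm$ signs are chosen independently (so there are $8$ forbidden triples $(a+b,a-b,c)$ mod $12$ in (iii) and $48$ mod $30$ in (iv)).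
   Context: A graph is a nut graph if $0$ is an adjacency eigenvalue of multiplicity one and a corresponding eigenvector has no zero entries. $B_2(m;a,b,c)$ is the graph on vertices $x_0,\dots,x_{m-1},y_0,\dots,y_{m-1}$ (indices mod $m$) with edges $x_ix_{i\pm a}$, $y_iy_{i\pm b}$, $x_iy_i$ and $x_iy_{i+c}$ for all $i$. For a nonzero integer $x$, $v_2(x)$ is the exponent of $2$ in the prime factorization of $|x|$. *)

(* Defs.v *)
From mathcomp Require Export all_boot all_order all_algebra.

Set Implicit Arguments.
Unset Strict Implicit.
Unset Printing Implicit Defensive.

Import Order.TTheory GRing.Theory Num.Theory.
Local Open Scope ring_scope.

Definition adjacency_mx (R : realFieldType) (T : finType) (e : rel T) :
    'M[R]_#|T| :=
  \matrix_(i, j) (e (enum_val i) (enum_val j))%:R.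

(* [e] is the edge relation of a simple graph, i.e. symmetric and irreflexive.
   The multiplicity is that of 0 as a root of the characteristic polynomial.
   The eigenvector is a row vector, as in mathcomp's [eigenspace]; the matrix
   being symmetric, row and column eigenvectors are transposes of each other. *)
Definition is_nut_graph (R : realFieldType) (T : finType) (e : rel T) : Prop :=
  let A := adjacency_mx R e in
  mup 0 (char_poly A) = 1%N /\
  exists v : 'rV[R]_#|T|,
    [/\ v != 0, (v <= eigenspace A 0)%MS & forall i, v 0 i != 0].

(* [inl i] is the vertex x_i and [inr i] is the vertex y_i. *)
Definition B2 (m : nat) (a b c : int) : rel ('I_m + 'I_m) :=
  fun u v => match u, v with
  | inl i, inl j => (j%:Z == i%:Z + a %[mod m])%Z
                 || (j%:Z == i%:Z - a %[mod m])%Z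
  | inr i, inr j => (j%:Z == i%:Z + b %[mod m])%Z
                 || (j%:Z == i%:Z - b %[mod m])%Z
  | inl i, inr j | inr j, inl i => (j == i) || (j%:Z == i%:Z + c %[mod m])%Z
  end.

Lemma B2_sym (m : nat) (a b c : int) : symmetric (@B2 m a b c).
Proof.
have sw (i j d : int) : (j == i + d %[mod m])%Z = (i == j - d %[mod m])%Z.
  by rewrite !eqz_mod_dvd -[in LHS]rpredN !opprB addrA.
by move=> [i|i] [j|j] //=; rewrite orbC; congr orb; rewrite -?sw // sw.
Qed.

Lemma B2_irr (m : nat) (a b c : int) :
  1 <= a -> a < m%:Z -> 1 <= b -> b < m%:Z -> irreflexive (@B2 m a b c).
Proof.
have sw (i d : int) : 1 <= d -> d < m%:Z ->
    (i == i + d %[mod m])%Z || (i == i - d %[mod m])%Z = false.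
  move=> d1 dm; rewrite !eqz_mod_dvd !opprD !opprK !addrA !subrr !add0r rpredN.
  rewrite orbb; apply/negbTE/negP => /dvdz_mod0P.
  rewrite modz_small => [d0|]; first by rewrite d0 in d1.
  by rewrite dm andbT (le_trans _ d1).
by move=> a1 am b1 bm [i|i] /=; rewrite sw.
Qed.

(* Meaningful for x != 0 only: v2 0 = 0. *)
Definition v2 (x : int) : nat := logn 2 `|x|%N.

Definition eqpm_mod (n x k : int) : bool :=
  (x == k %[mod n])%Z || (x == - k %[mod n])%Z.

Definition one_other_mod (n x y k l : int) : bool :=
  (eqpm_mod n x k && eqpm_mod n y l) || (eqpm_mod n y k && eqpm_mod n x l).

(* Main.v *)
(* Diagonalising the circulant blocks by the Fourier matrix, the characteristic
   polynomial of the adjacency matrix is a product over the m-th roots of unity z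
   of 2x2 determinants, whose constant terms are, with t(u) = u + 1/u,
   t(z^(a+b)) + t(z^(a-b)) - t(z^c) - 2. The factor at z = 1 always contributes a
   simple root 0 with eigenvector (1, -1), so the graph is a nut graph iff
   t(z^(a+b)) + t(z^(a-b)) + t(-z^c) <> 2 for every z <> 1.

   The solutions of t(x) + t(y) + t(z) = 2 in roots of unity are found by
   averaging over Galois groups. Let N be the least common exponent and p a prime
   dividing N. If p^2 divides N, averaging over Gal(Q(mu_N) / Q(mu_(N/p))) deletes
   the terms whose root of unity is not in mu_(N/p). If N = p M with p >= 5 prime
   to M, a relation between the p-th roots of unity over Q(mu_M) has equal
   coefficients; this leaves only the golden ratio solution, with p = 5. Otherwise
   all t's are integers. Up to order, the solutions are (2, s, -s), (0, 1, 1) and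
   (1, (1 + sqrt 5) / 2, (1 - sqrt 5) / 2): the first kind gives conditions (i) and
   (ii), the others give (iii) and (iv), since by (i) a root z with such values has
   order exactly 12 or 30 unless a bad root of the first kind exists too. *)

Require Import Defs.
From mathcomp Require Import all_fingroup all_field.
From mathcomp Require Import zify ring.
Import Order.TTheory GRing.Theory Num.Theory.
Local Open Scope ring_scope.

Set Implicit Arguments.
Unset Strict Implicit.
Unset Printing Implicit Defensive.

(** * Multiplicity of the root 0 and characteristic polynomials *)

Lemma mup0_eq1 (F : fieldType) (p : {poly F}) : p != 0 ->
  mup 0 p = 1%N <-> p`_0 = 0 /\ p`_1 != 0.
Proof.
move=> p0; have [/factor_theorem[q pq]|np] := boolP (root p 0); last first.
  rewrite mupNroot //; split=> // -[p00 _].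
  by move: np; rewrite /root horner_coef0 p00 eqxx.
have q0 : q != 0 by apply: contraNneq p0 => q0; rewrite pq q0 mul0r.
rewrite {1}pq mupM ?polyXsubC_eq0 // (@mup_XsubCX _ 1) eqxx.
rewrite pq subr0 !coefMX /= -horner_coef0 -rootE.
have -> : (mup 0 q + 1 = 1)%N <-> ~~ (0 < mup 0 q)%N by split; lia.
by rewrite -XsubC_dvd // dvdp_XsubCl; split=> [|[]].
Qed.

(** Simplicity of the root 0 depends only on the two lowest coefficients, which are integers here.
    This carries the question from [R] to [algC], where roots of unity are available. *)
Lemma mup0_map_intr (F G : numFieldType) (p : {poly int}) : p \is monic ->
  mup 0 (map_poly intr p : {poly F}) = 1%N <->
  mup 0 (map_poly intr p : {poly G}) = 1%N.
Proof.
move=> pm; have cF (K : numFieldType) i :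
    (map_poly intr p : {poly K})`_i = (p`_i)%:~R.
  exact: (coef_map (intr : {rmorphism int -> K})).
have mF (K : numFieldType) : (map_poly intr p : {poly K}) != 0.
  exact/monic_neq0/(monic_map (intr : {rmorphism int -> K})).
rewrite !mup0_eq1; [|exact: mF..].
rewrite !cF !intr_eq0.
by split=> -[/eqP]; rewrite intr_eq0 => /eqP ->.
Qed.

(** Serves to renumber vertices: the adjacency matrix is indexed by [#|T|], its block form by
    [m + m], two sizes that are equal but not convertible. *)
Lemma det_mxsub_bij (K : comNzRingType) n k (f : 'I_n -> 'I_k) (A : 'M[K]_k) :
  bijective f -> \det (mxsub f f A) = \det A.
Proof.
move=> fbij; have nk : n = k by rewrite -(card_ord n) -(card_ord k) (bij_eq_card fbij).
case: _ / nk f A fbij => f A /bij_inj finj.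
have -> : mxsub f f A = row_perm (perm finj) (col_perm (perm finj) A).
  by apply/matrixP=> i j; rewrite !mxE !permE.
rewrite row_permE col_permE !det_mulmx !det_perm mulrCA odd_permV -expr2 sqrr_sign.
by rewrite mulr1.
Qed.

Lemma char_poly_mxsub_bij (K : comNzRingType) n k (f : 'I_n -> 'I_k)
    (A : 'M[K]_k) : bijective f -> char_poly (mxsub f f A) = char_poly A.
Proof.
move=> fbij; rewrite /char_poly -(det_mxsub_bij _ fbij); congr (\det _).
by apply/matrixP=> i j; rewrite !mxE (inj_eq (bij_inj fbij)).
Qed.

Lemma char_poly_similar (K : idomainType) n (A B P : 'M[K]_n) :
  \det P != 0 -> A *m P = P *m B -> char_poly A = char_poly B.
Proof.
move=> P0 AB; have PX0 : \det (map_mx polyC P) != 0.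
  by rewrite det_map_mx polyC_eq0.
apply: (mulIf PX0); rewrite /char_poly -det_mulmx [RHS]mulrC -det_mulmx.
rewrite /char_poly_mx mulmxBl mulmxBr -!map_mxM AB.
by rewrite mul_scalar_mx mul_mx_scalar.
Qed.

(** Multiplying the characteristic matrix on the right by the block matrix with rows (e4, 0) and
    (e3, 1) makes it block upper triangular, because diagonal matrices commute. The common factor
    det e4 then cancels. *)
Lemma char_poly_block_diag (K : idomainType) n (d1 d2 d3 d4 : 'rV[K]_n) :
  char_poly (block_mx (diag_mx d1) (diag_mx d2) (diag_mx d3) (diag_mx d4)) =
  \prod_k (('X - (d1 0 k)%:P) * ('X - (d4 0 k)%:P) - (d2 0 k * d3 0 k)%:P).
Proof.
pose e1 := \row_k ('X - (d1 0 k)%:P); pose e4 := \row_k ('X - (d4 0 k)%:P).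
pose e2 := map_mx polyC d2; pose e3 := map_mx polyC d3.
have chE : char_poly_mx (block_mx (diag_mx d1) (diag_mx d2) (diag_mx d3)
    (diag_mx d4)) = block_mx (diag_mx e1) (- diag_mx e2) (- diag_mx e3) (diag_mx e4).
  rewrite /char_poly_mx map_block_mx scalar_mx_block -!map_diag_mx.
  rewrite opp_block_mx add_block_mx !add0r.
  by congr block_mx; apply/matrixP => i j; rewrite !mxE; case: eqP => //= _;
     rewrite ?mulr1n ?mulr0n ?subr0.
have E4 : \det (diag_mx e4) != 0.
  rewrite det_diag; apply/prodf_neq0 => i _; rewrite mxE polyXsubC_eq0 //.
apply: (mulIf E4); rewrite /char_poly chE.
have := det_lblock (diag_mx e4) (diag_mx e3) (1%:M : 'M_n).
rewrite det1 mulr1 => {1}<-; rewrite -det_mulmx mulmx_block.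
rewrite !mulmx0 !mulmx1 !add0r !mulNmx.
have -> : - (diag_mx e3 *m diag_mx e4) + diag_mx e4 *m diag_mx e3 = 0.
  by rewrite diag_mxC addNr.
rewrite det_ublock; congr (_ * _).
rewrite !mulmx_diag -raddfB /= det_diag; apply: eq_bigr => k _.
by rewrite !mxE polyCM.
Qed.

Lemma unity_neq0 (K : nzRingType) (x : K) n : (0 < n)%N -> x ^+ n = 1 -> x != 0.
Proof.
move=> n0; apply: contra_eq_neq => ->.
by rewrite expr0n gtn_eqF // eq_sym oner_eq0.
Qed.

Lemma expz_eqmod (x : algC) (n : nat) (i j : int) : (0 < n)%N -> x ^+ n = 1 ->
  (i = j %[mod n])%Z -> x ^ i = x ^ j.
Proof.
move=> n0 xn /eqP; rewrite eqz_mod_dvd => /dvdzP[q ij].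
have x0 := unity_neq0 n0 xn.
have -> : i = j + n%:Z * q by lia.
by rewrite expfzDr // -exprz_exp -[x ^ n]/(x ^+ n) xn exp1rz mulr1.
Qed.

(** * Cyclic shifts and the Fourier matrix *)

Definition shift_mx (K : nzRingType) m (d : int) : 'M[K]_m :=
  \matrix_(i, j) ((j%:Z == i%:Z + d %[mod m])%Z)%:R.

(** Column k of [F] lists the powers of w^k; shifting the index by d multiplies this column by
    w^(kd). *)
Lemma shift_mx_fourier m (w : algC) (d : int) : m.-primitive_root w ->
  let F := Vandermonde m (\row_(j < m) w ^+ j) in
  shift_mx _ m d *m F = F *m diag_mx (\row_k (w ^+ k) ^ d).
Proof.
move=> wp F; have m0 := prim_order_gt0 wp.
have wkm k : (w ^+ k) ^+ m = 1 by rewrite exprAC (prim_expr_order wp) expr1n.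
have w0 k : w ^+ k != 0 by exact: unity_neq0 m0 (wkm k).
apply/matrixP=> i k; rewrite mul_mx_diag !mxE.
have lt0 : (`|((i%:Z + d) %% m)%Z| < m)%N by lia.
(* Row i of the shift has its only 1 in the column of the residue of i + d. *)
rewrite (bigD1 (Ordinal lt0)) //= big1 => [|j /negP ji].
  rewrite !mxE /= gez0_abs; last by lia.
  rewrite modz_mod eqxx mul1r addr0.
  transitivity ((w ^+ k) ^ (i%:Z + d)); last by rewrite expfzDr.
  rewrite [LHS]exprnP; apply: (expz_eqmod m0 (wkm k)).
  by rewrite gez0_abs ?modz_mod //; lia.
rewrite !mxE; case: eqP => [e|]; last by rewrite mul0r.
case: ji; apply/eqP/val_inj => /=.
by rewrite -e modz_small /= ?ltz_nat ?ltn_ord // absz_nat.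
Qed.

Lemma det_fourier m (w : algC) : m.-primitive_root w ->
  \det (Vandermonde m (\row_(j < m) w ^+ j)) != 0.
Proof.
move=> wp; rewrite det_Vandermonde; apply/prodf_neq0 => i _.
apply/prodf_neq0 => j ij; rewrite !mxE subr_eq0 (eq_prim_root_expr wp).
rewrite !modn_small //; lia.
Qed.

Lemma ones_mul_shift_mx (K : nzRingType) m (d : int) : (0 < m)%N ->
  const_mx 1 *m shift_mx K m d = const_mx 1 :> 'rV_m.
Proof.
move=> m0; apply/rowP=> j; rewrite !mxE.
have lt0 : (`|((j%:Z - d) %% m)%Z| < m)%N by lia.
have eqm : (`|((j%:Z - d) %% m)%Z|%:Z + d = j%:Z %[mod m])%Z.
  by rewrite gez0_abs; [rewrite modzDml subrK | lia].
move: (`|_|%N) lt0 eqm => r lt0 eqm.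
rewrite (bigD1 (Ordinal lt0)) //= big1 => [|i /negP ij].
  by rewrite !mxE /= eqm eqxx mul1r addr0.
rewrite !mxE mul1r; case: eqP => // e; case: ij; apply/eqP/val_inj => /=.
move: eqm; rewrite e => /eqP.
rewrite eqz_mod_dvd opprD addrACA subrr addr0 -eqz_mod_dvd => /eqP.
by rewrite !modz_small ?ltz_nat ?ltn_ord // => -[->].
Qed.

Lemma shift_mx0 (K : nzRingType) m : shift_mx K m 0 = 1%:M.
Proof.
apply/matrixP=> i j; rewrite !mxE addr0 !modz_small ?ltz_nat ?ltn_ord //.
by rewrite eqz_nat eq_sym.
Qed.

(** * The spectrum of [B2] and the nut criterion in roots of unity *)

Definition twocos (z : algC) : algC := z + z^-1.

Section B2Spectrum.
Variables (m : nat) (a b c : int).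
Hypotheses (hm : (3 <= m)%N) (ha : 1 <= a) (hab : a <= b) (hb : 2 * b < m%:Z)
  (hc : 1 <= c) (hcm : 2 * c <= m%:Z).

Let T := ('I_m + 'I_m)%type.
(** An integer matrix, whose images under [intr] are the adjacency matrices over [R] and over
    [algC]. *)
Let Az : 'M[int]_#|{: T}| :=
  \matrix_(i, j) (B2 a b c (enum_val i) (enum_val j))%:R.

Let blk (K : nzRingType) : 'M[K]_(m + m) :=
  block_mx (shift_mx K m a + shift_mx K m (- a)) (1%:M + shift_mx K m c)
           (1%:M + shift_mx K m (- c)) (shift_mx K m b + shift_mx K m (- b)).

Let f (k : 'I_(m + m)) : 'I_#|{: T}| := enum_rank (split k).

Let f_bij : bijective f.
Proof.
exists (fun i => unsplit (enum_val i)) => k; rewrite /f ?enum_rankK ?splitK //.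
by rewrite unsplitK enum_valK.
Qed.

(** The bounds on a, b, c make the two alternatives in each adjacency test exclusive, so a boolean
    disjunction becomes a sum of shift matrices: 2d < m separates i + d from i - d, and 0 < c < m
    separates i from i + c. *)
Let blkE (K : nzRingType) : mxsub f f (map_mx intr Az) = blk K.
Proof.
have nz (i j : 'I_m) (d : int) : 0 < d -> 2 * d < m%:Z ->
    (((j%:Z == i%:Z + d %[mod m]) || (j%:Z == i%:Z - d %[mod m]))%Z%:R : K) =
    (j%:Z == i%:Z + d %[mod m])%Z%:R + (j%:Z == i%:Z - d %[mod m])%Z%:R.
  move=> d0 dm; case: eqP => e1; case: eqP => e2; rewrite ?addr0 ?add0r //.
  exfalso; have : (i%:Z + d == i%:Z - d %[mod m])%Z by rewrite -e1 -e2.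
  rewrite eqz_mod_dvd; have -> : i%:Z + d - (i%:Z - d) = 2 * d by lia.
  by rewrite dvdzE gtnNdvd //=; lia.
have nz' (i j : 'I_m) (d : int) : (0 < `|d|)%N -> (`|d| < m)%N ->
    (((j == i) || (j%:Z == i%:Z + d %[mod m])%Z)%:R : K) =
    (i == j)%:R + (j%:Z == i%:Z + d %[mod m])%Z%:R.
  move=> d0 dm; rewrite (eq_sym j); case: eqP => [->|_]; last by rewrite add0r.
  case: eqP => [e|]; last by rewrite addr0.
  exfalso; have : (j%:Z == j%:Z + d %[mod m])%Z by rewrite -e.
  rewrite eqz_mod_dvd; have -> : j%:Z - (j%:Z + d) = - d by lia.
  by rewrite dvdzE gtnNdvd //=; lia.
have sw (i j : 'I_m) (d : int) :
   (i%:Z == j%:Z + d %[mod m])%Z = (j%:Z == i%:Z - d %[mod m])%Z.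
  by rewrite !eqz_mod_dvd -[in LHS]rpredN !opprB addrA.
apply/matrixP=> u v; rewrite !mxE /f !enum_rankK.
case: (split u) => i; rewrite !mxE; case: (split v) => j; rewrite !mxE /=.
- by rewrite natz -pmulrn -nz //; lia.
- by rewrite natz -pmulrn nz' //; lia.
- by rewrite natz -pmulrn (eq_sym i) sw nz' 1?eq_sym //; lia.
- by rewrite natz -pmulrn -nz //; lia.
Qed.

Let det_symbol (z : algC) : z != 0 ->
  (z ^ a + z ^ (- a)) * (z ^ b + z ^ (- b)) - (1 + z ^ c) * (1 + z ^ (- c)) =
  twocos (z ^ (a + b)) + twocos (z ^ (a - b)) - twocos (z ^ c) - 2.
Proof.
move=> z0; rewrite /twocos !expfzDr // -!invr_expz !invfM invrK.
have za := expfz_neq0 a z0; have zb := expfz_neq0 b z0.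
have zc := expfz_neq0 c z0; field; by rewrite za zb zc.
Qed.

Lemma mup_B2 (R : realFieldType) :
  mup 0 (char_poly (adjacency_mx R (@B2 m a b c))) = 1%N <->
  forall z : algC, z ^+ m = 1 -> z != 1 ->
    twocos (z ^ (a + b)) + twocos (z ^ (a - b)) - twocos (z ^ c) != 2.
Proof.
have -> : adjacency_mx R (@B2 m a b c) = map_mx intr Az.
  by apply/matrixP=> i j; rewrite !mxE natz -pmulrn.
have chE (K : numFieldType) : char_poly (map_mx intr Az : 'M[K]__) =
    map_poly intr (char_poly Az).
  exact/esym/(map_char_poly (intr : {rmorphism int -> K})).
rewrite chE (mup0_map_intr R algC (char_poly_monic _)) -chE.
rewrite -(char_poly_mxsub_bij _ f_bij) blkE.
have m0 : (0 < m)%N by apply: leq_trans hm.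
have [w wp] := C_prim_root_exists m0.
pose F := Vandermonde m (\row_(j < m) w ^+ j).
pose d1 := \row_(k < m) ((w ^+ k) ^ a + (w ^+ k) ^ (- a)).
pose d2 := \row_(k < m) (1 + (w ^+ k) ^ c).
pose d3 := \row_(k < m) (1 + (w ^+ k) ^ (- c)).
pose d4 := \row_(k < m) ((w ^+ k) ^ b + (w ^+ k) ^ (- b)).
have FD (d e : int) : (shift_mx _ m d + shift_mx _ m e) *m F =
    F *m diag_mx (\row_k ((w ^+ k) ^ d + (w ^+ k) ^ e)).
  rewrite mulmxDl !shift_mx_fourier // -mulmxDr -raddfD /=; congr (_ *m diag_mx _).
  by apply/rowP=> k; rewrite !mxE.
have sim : blk _ *m block_mx F 0 0 F = block_mx F 0 0 F *m
    block_mx (diag_mx d1) (diag_mx d2) (diag_mx d3) (diag_mx d4).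
  by rewrite !mulmx_block !mulmx0 !mul0mx !addr0 !add0r -shift_mx0 !FD.
rewrite (char_poly_similar _ sim); last first.
  by rewrite det_lblock mulf_neq0 ?det_fourier.
pose q k := ('X - (d1 0 k)%:P) * ('X - (d4 0 k)%:P) - (d2 0 k * d3 0 k)%:P.
have wk0 k : w ^+ k != 0.
  by rewrite (@unity_neq0 _ _ m) // exprAC (prim_expr_order wp) expr1n.
have qk k : root (q k) 0 =
  (twocos ((w ^+ k) ^ (a + b)) + twocos ((w ^+ k) ^ (a - b))
     - twocos ((w ^+ k) ^ c) == 2).
  rewrite -[RHS]subr_eq0 -det_symbol // rootE /q !hornerE mulrNN.
  by rewrite !mxE.
have := char_poly_monic (block_mx (diag_mx d1) (diag_mx d2) (diag_mx d3) (diag_mx d4)).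
rewrite char_poly_block_diag -/q => /monic_neq0.
rewrite (bigD1 (Ordinal m0)) //= -/(q _) mulf_eq0 negb_or => /andP[q0 Q0].
(* At index 0 the four entries all equal 2, so this factor is X (X - 4), where 0 is a simple root.
   The other factors must then not vanish at 0. *)
rewrite mupM // [mup 0 (q _)](_ : _ = 1%N); last first.
  apply/mup0_eq1 => //; rewrite -horner_coef0 !hornerE !mxE /= expr0 !exp1rz.
  split; first by ring.
  rewrite /q; set x := d1 _ _; set y := d4 _ _; set e := d2 _ _ * _.
  have -> : ('X - x%:P) * ('X - y%:P) - e%:P =
      'X * ('X - (x + y)%:P) + (x * y - e)%:P by ring.
  rewrite coefD coefXM coefC coefB coefX coefC /= addr0 sub0r oppr_eq0.
  rewrite /x /y !mxE expr0 !exp1rz (_ : _ + _ = 4%:R) ?pnatr_eq0 //; ring.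
move: Q0; set Q := \prod_(_ < _ | _) _ => Q0.
have -> : (1 + mup 0 Q = 1)%N <-> ~~ (0 < mup 0 Q)%N by split; lia.
rewrite -XsubC_dvd // dvdp_XsubCl rootE horner_prod.
split=> [/prodf_neq0 H z zm z1|H].
  have [i zi] := prim_rootP wp zm.
  have i0 : i != Ordinal m0.
    by apply: contraNneq z1 => i0; rewrite zi i0.
  by have := H i i0; rewrite -rootE qk zi.
apply/prodf_neq0 => i i0; rewrite -rootE qk; apply: H.
  by rewrite exprAC (prim_expr_order wp) expr1n.
rewrite -(prim_order_dvd wp) gtnNdvd // lt0n.
by apply: contraNneq i0 => i0; apply/eqP/val_inj.
Qed.

(** The vector equal to 1 on the x side and -1 on the y side is in the kernel, since every vertex
    has two neighbours on each side. So only the multiplicity remains to be studied. *)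
Lemma B2_full_kernel (R : realFieldType) :
  let A := adjacency_mx R (@B2 m a b c) in
  exists v : 'rV[R]_#|{: T}|,
    [/\ v != 0, (v <= eigenspace A 0)%MS & forall i, v 0 i != 0].
Proof.
have m0 : (0 < m)%N by apply: leq_trans hm.
pose v0 : 'rV[R]_(m + m) := row_mx (const_mx 1) (- const_mx 1).
have v0B : v0 *m blk R = 0.
  rewrite mul_row_block !mulmxDr !mulNmx !mulmx1 !ones_mul_shift_mx //.
  by rewrite -opprD addrN row_mx0.
have v0n k : v0 0 k != 0.
  rewrite !mxE; case: split => j; rewrite !mxE ?oppr_eq0 oner_eq0 //.
have [g fK gK] := f_bij.
exists (colsub g v0); split.
- have i0 : 'I_#|{: T}| by exact: f (lshift m (Ordinal m0)).
  apply/eqP => /rowP/(_ i0); rewrite !mxE => /eqP.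
  by apply/negP; have := v0n (g i0); rewrite !mxE.
- apply/sub_kermxP; rewrite raddf0 subr0; apply/rowP=> j.
  rewrite !mxE (reindex f) /=; last by exists g => ? _.
  rewrite -[RHS](_ : (v0 *m blk R) 0 (g j) = _); last by rewrite v0B mxE.
  rewrite -blkE mxE; apply: eq_bigr => k _; rewrite !mxE fK gK.
  by rewrite natz -pmulrn.
- by move=> i; rewrite mxE.
Qed.

Lemma nut_B2 (R : realFieldType) :
  is_nut_graph R (@B2 m a b c) <->
  forall z : algC, z ^+ m = 1 -> z != 1 ->
    twocos (z ^ (a + b)) + twocos (z ^ (a - b)) - twocos (z ^ c) != 2.
Proof.
rewrite -(mup_B2 R); split=> [[]//|mup1]; split=> //; exact: B2_full_kernel.
Qed.

End B2Spectrum.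

(** * Galois averaging of relations between roots of unity *)

Lemma sum_exp_unity (K : idomainType) (z : K) n : z ^+ n = 1 ->
  \sum_(j < n) z ^+ j = (z == 1)%:R * n%:R.
Proof.
move=> zn; case: eqP => [->|/eqP z1].
  rewrite mul1r (eq_bigr (fun=> 1)) ?sumr_const ?card_ord // => j _.
  by rewrite expr1n.
have /esym/eqP := subrX1 z n.
by rewrite zn subrr mulf_eq0 subr_eq0 (negPf z1) mul0r => /eqP.
Qed.

(** Let N be the least common exponent. Unless N divides 6, take a prime p dividing N / gcd(N, 6)
    and M = N / p. If p does not divide M, then p is prime to 6, as otherwise p would divide both N
    / gcd(N, 6) and gcd(N, 6), making p^2 divide N. *)
Lemma reduce_exponent (s : seq algC) n : (0 < n)%N ->
  all (fun u => u ^+ n == 1) s ->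
  [\/ exists p M, [/\ prime p, (p %| M)%N, (0 < M)%N,
        all (fun u => u ^+ (p * M) == 1) s & ~~ all (fun u => u ^+ M == 1) s],
      exists p M, [/\ prime p, (4 < p)%N, coprime p M, (0 < M)%N &
        all (fun u => u ^+ (p * M) == 1) s /\ ~~ all (fun u => u ^+ M == 1) s] |
      all (fun u => u ^+ 6 == 1) s].
Proof.
move=> n0 sn.
have exN : exists N, (0 < N)%N && all (fun u => u ^+ N == 1) s.
  by exists n; rewrite n0.
case: (ex_minnP exN) => N /andP[N0 sN] Nmin.
have drop p M : prime p -> N = (p * M)%N ->
    (0 < M)%N /\ ~~ all (fun u => u ^+ M == 1) s.
  move=> pp NE; have M0 : (0 < M)%N by move: N0; rewrite NE muln_gt0 => /andP[].
  split=> //; apply/negP => sM; have := Nmin M; rewrite M0 sM => /(_ isT).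
  by have := prime_gt1 pp; rewrite NE; nia.
have [/eqP g1|g1] := boolP (N %/ gcdn N 6 == 1)%N.
  apply: Or33; have /dvdnP[q q6] : (N %| 6)%N.
    by apply/gcdn_idPl; have /divnK := dvdn_gcdl N 6; rewrite g1 mul1n.
  apply: sub_all sN => u /eqP uN.
  by rewrite q6 mulnC exprM uN expr1n.
have g0 : (0 < gcdn N 6)%N by rewrite gcdn_gt0 N0.
pose p := pdiv (N %/ gcdn N 6).
have NK : N = (N %/ gcdn N 6 * gcdn N 6)%N by rewrite divnK // dvdn_gcdl.
have pp : prime p by apply: pdiv_prime; move: g1 N0 NK; nia.
have pK : (p %| N %/ gcdn N 6)%N := pdiv_dvd _.
have /dvdnP[M NE] : (p %| N)%N by rewrite NK dvdn_mulr.
rewrite mulnC in NE.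
have [M0 sM] := drop p M pp NE.
have [pM|pM] := boolP (p %| M)%N.
  by apply: Or31; exists p, M; split=> //; rewrite -NE.
have cpM : coprime p M by rewrite prime_coprime.
have p6 : ~~ (p %| 6)%N.
  apply/negP => p6; case/negP: pM.
  rewrite -(@dvdn_pmul2l p) ?prime_gt0 // -NE NK; apply: dvdn_mul => //.
  by rewrite dvdn_gcd p6 NE dvdn_mulr.
apply: Or32; exists p, M; split=> //; last by rewrite -NE.
by case: p pp p6 {pK NE cpM pM} => [|[|[|[|[|]]]]].
Qed.

(** The automorphisms raising roots of unity to the power 1 + jM, for j < p, send u to u (u^M)^j. As
    u^M is a p-th root of unity, the images of u sum to p u if u^M = 1 and to 0 otherwise. *)
Lemma nonsquarefree_average (p M : nat) (s t : seq algC) :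
  prime p -> (p %| M)%N -> (0 < M)%N ->
  all (fun u => u ^+ (p * M) == 1) s -> all (fun u => u ^+ (p * M) == 1) t ->
  \sum_(u <- s) u = \sum_(u <- t) u ->
  \sum_(u <- s | u ^+ M == 1) u = \sum_(u <- t | u ^+ M == 1) u.
Proof.
move=> pp pM M0 sN tN st.
(* A number prime to [M] is also prime to [p], which divides [M]. *)
have co j : coprime (1 + j * M) (p * M).
  have c1 : coprime (1 + j * M) M by rewrite -coprime_modl addnC modnMDl coprime_modl coprime1n.
  by rewrite coprimeMr c1 andbT (coprime_dvdr pM c1).
pose sg j := sval (Qn_aut_exists (co j)).
have sgE j u : u ^+ (p * M) == 1 -> sg j u = u * (u ^+ M) ^+ j.
  move=> /eqP uN; rewrite /sg (svalP (Qn_aut_exists (co j))) //.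
  by rewrite exprD expr1 mulnC exprM.
have avg r : all (fun u => u ^+ (p * M) == 1) r ->
    \sum_(j < p) sg j (\sum_(u <- r) u) = p%:R * \sum_(u <- r | u ^+ M == 1) u.
  move=> rN; under eq_bigr do rewrite rmorph_sum /=.
  rewrite exchange_big /= big_distrr /= [RHS]big_mkcond /=.
  apply: eq_big_seq => u /(allP rN) uN.
  under eq_bigr do rewrite sgE //.
  rewrite -mulr_sumr sum_exp_unity; last by rewrite -exprM mulnC; apply/eqP.
  by case: eqP => _; rewrite ?mul1r ?mul0r ?mulr0 // mulrC.
have p0 : p%:R != 0 :> algC by rewrite pnatr_eq0 -lt0n prime_gt0.
by apply: (mulfI p0); rewrite -!avg // st.
Qed.

(** The automorphism of index j raises roots of unity of order dividing pM to a power k that is j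
    mod p and 1 mod M, given by the Chinese remainder theorem. *)
Lemma squarefree_auts (p M : nat) : prime p -> coprime p M ->
  exists sg : nat -> {rmorphism algC -> algC},
    (forall j v, (0 < j < p)%N -> v ^+ M = 1 -> sg j v = v) /\
    (forall j z, (0 < j < p)%N -> z ^+ p = 1 -> sg j z = z ^+ j).
Proof.
move=> pp cpM.
have ex j : {f : {rmorphism algC -> algC} | (0 < j < p)%N ->
    (forall v, v ^+ M = 1 -> f v = v) /\ (forall z, z ^+ p = 1 -> f z = z ^+ j)}.
  (* Outside the range of j the identity is a mere default. *)
  case: (boolP (0 < j < p)%N) => [/andP[j0 jp]|_]; last by exists idfun.
  pose k := chinese p M j 1.
  have kj : k = j %[mod p] by exact: chinese_modl.
  have k1 : k = 1 %[mod M] by exact: chinese_modr.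
  have co : coprime k (p * M).
    rewrite coprimeMr -coprime_modl kj coprime_modl -[X in _ && X]coprime_modl k1.
    rewrite coprime_modl coprime1n andbT coprime_sym prime_coprime //.
    by rewrite gtnNdvd.
  have [f fE] := Qn_aut_exists co; exists f => _; split=> [v vM|z zp].
    rewrite fE; last by rewrite mulnC exprM vM expr1n.
    by rewrite -(expr_mod _ vM) k1 (expr_mod _ vM) expr1.
  rewrite fE; last by rewrite exprM zp expr1n.
  by rewrite -(expr_mod _ zp) kj (expr_mod _ zp).
exists (fun j => sval (ex j)); split=> j x jp xE.
  by have [-> //] := svalP (ex j) jp.
by have [_ -> //] := svalP (ex j) jp.
Qed.

(* The converse of the fact that the p-th roots of unity sum to 0: a relation
   between them with coefficients fixed by Gal(Q(mu_pM) / Q(mu_M)) has all its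
   coefficients equal. Indeed p times the coefficient of w is the sum of them
   all, as one sees by averaging the relation divided by w over this group. *)
Lemma squarefree_relation (p : nat) (sg : nat -> {rmorphism algC -> algC})
    (s : seq (algC * algC)) (w : algC) : prime p ->
  (forall j z, (0 < j < p)%N -> z ^+ p = 1 -> sg j z = z ^+ j) ->
  all (fun x => x.1 ^+ p == 1) s ->
  (forall j x, (0 < j < p)%N -> x \in s -> sg j x.2 = x.2) ->
  \sum_(x <- s) x.1 * x.2 = 0 -> w ^+ p = 1 ->
  \sum_(x <- s) x.2 = p%:R * \sum_(x <- s | x.1 == w) x.2.
Proof.
move=> pp sgz sp sgf rel wp.
have w0 : w != 0 by apply: unity_neq0 (prime_gt0 pp) wp.
have : \sum_(1 <= j < p) sg j (w^-1 * \sum_(x <- s) x.1 * x.2) = 0.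
  by rewrite rel mulr0 big1 // => j _; rewrite rmorph0.
under eq_big_nat => j jp.
  rewrite mulr_sumr rmorph_sum /=.
  rewrite (eq_big_seq (fun x => (x.1 / w) ^+ j * x.2)); last first.
    move=> x xs; rewrite mulrA rmorphM /= sgf // mulrC -[RHS]mulrC.
    congr (_ * _); rewrite mulrC sgz // exprMn exprVn wp invr1 mulr1.
    exact/eqP/(allP sp).
  over.
rewrite exchange_big /=.
rewrite (eq_big_seq (fun x => p%:R * (x.1 == w)%:R * x.2 - x.2)); last first.
  move=> x xs; rewrite -mulr_suml -[X in _ - X]mul1r -mulrBl; congr (_ * _).
  have xw : (x.1 / w) ^+ p = 1.
    by rewrite exprMn exprVn wp invr1 mulr1; exact/eqP/(allP sp).
  have := sum_exp_unity xw; rewrite -(big_mkord xpredT (fun j => (x.1 / w) ^+ j)).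
  rewrite big_ltn ?prime_gt0 // expr0 -[X in _ == X](mulfV w0).
  rewrite (inj_eq (mulIf (invr_neq0 w0))) [p%:R * _]mulrC => <-.
  by rewrite addrAC subrr add0r.
rewrite sumrB => /eqP; rewrite subr_eq0 => /eqP <-.
rewrite mulr_sumr [RHS]big_mkcond /=; apply: eq_bigr => x _.
by case: eqP => _; rewrite ?mulr1 // mulr0 mul0r.
Qed.

(** The exponents e = (0 mod p, 1 mod M) and f = (1 mod p, 0 mod M) sum to 1 mod pM, whence u = u^f
    u^e. The last clause says that z is nontrivial exactly for the roots that are not M-th roots of
    unity, called moving below. *)
Lemma unity_split (K : fieldType) (p M : nat) (u : K) :
  (0 < p)%N -> (0 < M)%N -> coprime p M -> u ^+ (p * M) = 1 ->
  exists z v : K, [/\ u = z * v, z ^+ p = 1, v ^+ M = 1 & (z == 1) = (u ^+ M == 1)].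
Proof.
move=> p0 M0 cpM uN; pose e := chinese p M 0 1; pose f := chinese p M 1 0.
have pe : (p %| e)%N by rewrite /dvdn chinese_modl // mod0n.
have Mf : (M %| f)%N by rewrite /dvdn chinese_modr // mod0n.
have fe1 : f + e = 1 %[mod p * M].
  apply/eqP; rewrite chinese_remainder //; apply/andP; split; apply/eqP.
    by rewrite -modnDm !chinese_modl // modnDm.
  by rewrite -modnDm !chinese_modr // modnDm.
have zp : (u ^+ f) ^+ p = 1.
  by case/dvdnP: Mf => q ->; rewrite -exprM -mulnA mulnC [(M * p)%N]mulnC exprM uN expr1n.
have vM : (u ^+ e) ^+ M = 1.
  by case/dvdnP: pe => q ->; rewrite -exprM -mulnA mulnC exprM uN expr1n.
have uE : u = u ^+ f * u ^+ e.
  by rewrite -exprD -(expr_mod _ uN) fe1 (expr_mod _ uN).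
exists (u ^+ f), (u ^+ e); split=> //.
apply/eqP/eqP => [z1|uM]; first by rewrite uE z1 mul1r.
by case/dvdnP: Mf => q ->; rewrite mulnC exprM uM expr1n.
Qed.

Lemma unity_norm (u : algC) n : (0 < n)%N -> u ^+ n = 1 -> `|u| = 1.
Proof.
move=> n0 un; apply/eqP.
by rewrite -(pexpr_eq1 n0) // -normrX un normr1.
Qed.

(** * Relations with one, two or only moving terms *)

Lemma twocos_norm_le (u : algC) n : (0 < n)%N -> u ^+ n = 1 -> `|twocos u| <= 2.
Proof.
move=> n0 un; apply: le_trans (ler_normD _ _) _.
by rewrite normfV (unity_norm n0 un) invr1.
Qed.

Lemma twocosV (u : algC) : twocos u^-1 = twocos u.
Proof. by rewrite /twocos invrK addrC. Qed.

Lemma twocosZM (u z v : algC) : u = z * v ->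
  twocos u = z * v + z^-1 * v^-1.
Proof. by move=> ->; rewrite /twocos invfM. Qed.

Lemma prime_unity_neq (p k : nat) (z : algC) : prime p -> z ^+ p = 1 -> z != 1 ->
  (0 < k < p)%N -> z ^+ k != 1.
Proof.
move=> pp zp z1 kp; apply: contraNneq z1 => zk.
have cpk : coprime p k by rewrite prime_coprime // gtnNdvd; case/andP: kp.
have [[|m] n e _] := egcdnP k (prime_gt0 pp).
  by move: e; rewrite (eqP cpk) addn1.
have := congr1 (fun i => z ^+ i) e.
rewrite mulnC exprM zp expr1n exprD mulnC exprM zk expr1n mul1r.
by rewrite (eqP cpk) => /esym/eqP.
Qed.

Section Squarefree.
Variables (p M : nat) (sg : nat -> {rmorphism algC -> algC}).
Hypotheses (pp : prime p) (p4 : (4 < p)%N) (M0 : (0 < M)%N).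
Hypothesis sgv : forall j v, (0 < j < p)%N -> v ^+ M = 1 -> sg j v = v.
Hypothesis sgz : forall j z, (0 < j < p)%N -> z ^+ p = 1 -> sg j z = z ^+ j.

(** Stands in for membership in Q(mu_M). *)
Let fixed (K : algC) := forall j, (0 < j < p)%N -> sg j K = K.

Lemma fixed_twocos v : v ^+ M = 1 -> fixed (twocos v).
Proof.
by move=> vM j jp; rewrite /twocos rmorphD /= fmorphV sgv.
Qed.

Lemma fixedB K L : fixed K -> fixed L -> fixed (K - L).
Proof. by move=> hK hL j jp; rewrite rmorphB hK ?hL. Qed.

Lemma fixed_nat n : fixed n%:R.
Proof. by move=> j jp; rewrite rmorph_nat. Qed.

(** As p > 3, z^2 differs from 1, z and 1/z, so its coefficient in the relation is 0. All
    coefficients are equal, yet that of z is v, which is nonzero. *)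
Lemma one_moving (z v K : algC) : z ^+ p = 1 -> z != 1 -> v ^+ M = 1 -> fixed K ->
  z * v + z^-1 * v^-1 <> K.
Proof.
move=> zp z1 vM fK rel.
have z0 := unity_neq0 (prime_gt0 pp) zp; have v0 := unity_neq0 M0 vM.
have z2 : z ^+ 2 != 1 by apply: prime_unity_neq zp z1 _ => //; lia.
have z3 : z ^+ 3 != 1 by apply: prime_unity_neq zp z1 _ => //; lia.
pose s : seq (algC * algC) := [:: (1, - K); (z, v); (z^-1, v^-1)].
have sp : all (fun x => x.1 ^+ p == 1) s.
  by rewrite /= expr1n exprVn zp invr1 eqxx.
have sf j x : (0 < j < p)%N -> x \in s -> sg j x.2 = x.2.
  move=> jp; rewrite !inE => /or3P[] /eqP-> /=.
  - by rewrite rmorphN fK.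
  - exact: sgv.
  - by rewrite fmorphV sgv.
have s0 : \sum_(x <- s) x.1 * x.2 = 0.
  by rewrite !big_cons big_nil /= mul1r addr0 rel addNr.
have R w := squarefree_relation pp sgz sp sf s0 (w := w).
have := R (z ^+ 2); rewrite exprAC zp expr1n => /(_ erefl).
have := R z zp; rewrite !big_cons !big_nil /=.
have zz : (1 == z) = false by rewrite eq_sym; apply/negbTE.
have zzz : (z^-1 == z) = false.
  by rewrite -(inj_eq (mulIf z0)) mulVf // -expr2 eq_sym; apply/negbTE.
have zz2 : (1 == z ^+ 2) = false by rewrite eq_sym; apply/negbTE.
have z2z : (z == z ^+ 2) = false.
  by rewrite -[X in X == _]mulr1 expr2 (inj_eq (mulfI z0)).
have z2V : (z^-1 == z ^+ 2) = false.
  by rewrite -(inj_eq (mulIf z0)) mulVf // -exprSr eq_sym; apply/negbTE.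
rewrite zz zzz zz2 z2z z2V eqxx mulr0 => -> /eqP.
by rewrite addr0 mulf_eq0 (negPf v0) pnatr_eq0 orbF; case: p pp.
Qed.

(** All coefficients of the relation equal that of 1, which is -K. If z2 is z1 or its inverse, z1^2
    does not occur and K = 0. Otherwise 1, z1, 1/z1, z2, 1/z2 are distinct, so v1, 1/v1 and v2 all
    equal -K. *)
Lemma two_moving (z1 v1 z2 v2 K : algC) : z1 ^+ p = 1 -> z1 != 1 -> v1 ^+ M = 1 ->
  z2 ^+ p = 1 -> z2 != 1 -> v2 ^+ M = 1 -> fixed K ->
  (z1 * v1 + z1^-1 * v1^-1) + (z2 * v2 + z2^-1 * v2^-1) = K ->
  K = 0 \/ [/\ p = 5%N, z1 != z2, z1 * z2 != 1, v1 = - K & v2 = - K] /\ K ^+ 2 = 1.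
Proof.
move=> z1p z11 v1M z2p z21 v2M fK rel.
have z10 := unity_neq0 (prime_gt0 pp) z1p.
have z20 := unity_neq0 (prime_gt0 pp) z2p.
have v10 := unity_neq0 M0 v1M; have v20 := unity_neq0 M0 v2M.
have z12 : z1 ^+ 2 != 1 by apply: prime_unity_neq z1p z11 _ => //; lia.
have z22 : z2 ^+ 2 != 1 by apply: prime_unity_neq z2p z21 _ => //; lia.
have z13 : z1 ^+ 3 != 1 by apply: prime_unity_neq z1p z11 _ => //; lia.
have p0 : p%:R != 0 :> algC by rewrite pnatr_eq0; case: p pp.
pose s : seq (algC * algC) := [:: (1, - K); (z1, v1); (z1^-1, v1^-1); (z2, v2); (z2^-1, v2^-1)].
have sp : all (fun x => x.1 ^+ p == 1) s.
  by rewrite /= expr1n !exprVn z1p z2p invr1 eqxx.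
have sf j x : (0 < j < p)%N -> x \in s -> sg j x.2 = x.2.
  move=> jp; rewrite !inE => /or4P[||| /orP[]] /eqP-> /=.
  - by rewrite rmorphN fK.
  - exact: sgv.
  - by rewrite fmorphV sgv.
  - exact: sgv.
  - by rewrite fmorphV sgv.
have s0 : \sum_(x <- s) x.1 * x.2 = 0.
  by rewrite !big_cons big_nil /= mul1r addr0 addrA -rel; ring.
have R w := squarefree_relation pp sgz sp sf s0 (w := w).
have nV (z : algC) : z != 0 -> (z^-1 == z) = (z ^+ 2 == 1).
  by move=> z0; rewrite -(inj_eq (mulIf z0)) mulVf // -expr2 eq_sym.
have nVV (x y : algC) : x != 0 -> (x^-1 == y) = (x * y == 1).
  by move=> x0; rewrite -(inj_eq (mulfI x0)) mulfV // eq_sym.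
have R1 := R 1 (expr1n _ _).
rewrite [X in _ = _ * X]big_mkcond !big_cons !big_nil /= in R1.
rewrite eqxx !invr_eq1 (negPf z11) (negPf z21) !addr0 in R1.
have [z12e|] := boolP ((z1 == z2) || (z1 * z2 == 1)).
  left; have := R (z1 ^+ 2); rewrite exprAC z1p expr1n => /(_ erefl).
  rewrite [X in _ = _ * X]big_mkcond !big_cons !big_nil /= !addr0 R1.
  have -> : (1 == z1 ^+ 2) = false by rewrite eq_sym (negPf z12).
  have e1 : (z1 == z1 ^+ 2) = false.
    by rewrite -[X in X == _]mulr1 expr2 (inj_eq (mulfI z10)) eq_sym (negPf z11).
  have e2 : (z1^-1 == z1 ^+ 2) = false by rewrite nVV // -exprS (negPf z13).
  rewrite e1 e2.
  have -> : (z2 == z1 ^+ 2) = false.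
    case/orP: z12e => [/eqP<- //|]; rewrite -nVV // => /eqP<- //.
  have -> : (z2^-1 == z1 ^+ 2) = false.
    case/orP: z12e => [/eqP<- //|]; rewrite -nVV // => /eqP<- //.
    by rewrite invrK.
  by rewrite !addr0 mulr0 => /eqP; rewrite mulf_eq0 (negPf p0) oppr_eq0 => /eqP.
rewrite negb_or => /andP[ne nem]; right.
have nem' : z2 * z1 != 1 by rewrite mulrC.
have E1 := R z1 z1p; have E1V := R z1^-1; have E2 := R z2 z2p.
rewrite exprVn z1p invr1 in E1V; have {}E1V := E1V erefl.
rewrite [X in _ = _ * X]big_mkcond !big_cons !big_nil /= !addr0 R1 in E1.
rewrite [X in _ = _ * X]big_mkcond !big_cons !big_nil /= !addr0 R1 in E1V.
rewrite [X in _ = _ * X]big_mkcond !big_cons !big_nil /= !addr0 R1 in E2.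
have ne' : (z2 == z1) = false by rewrite eq_sym (negPf ne).
have f1 : (1 == z1) = false by rewrite eq_sym (negPf z11).
have f2 : (1 == z2) = false by rewrite eq_sym (negPf z21).
rewrite f1 eqxx nV // (negPf z12) ne' nVV // (negPf nem') !add0r !addr0 in E1.
rewrite f2 eqxx nV // (negPf z22) (negPf ne) nVV // (negPf nem) !add0r !addr0 in E2.
rewrite eq_sym invr_eq1 (negPf z11) eqxx [z1 == _]eq_sym nV // (negPf z12) in E1V.
rewrite [z2 == _]eq_sym nVV // (negPf nem) (inj_eq invr_inj) ne' !add0r !addr0 in E1V.
have v1K := mulfI p0 E1; have v1VK := mulfI p0 E1V; have v2K := mulfI p0 E2.
have K2 : K ^+ 2 = 1 by rewrite expr2 -mulrNN {1}v1K v1VK mulfV.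
have K0 : K != 0 by apply: unity_neq0 K2.
have v2V : v2^-1 = v1^-1 by rewrite -v2K v1K.
(* The five coefficients -K must sum to p times one of them. *)
have : (p%:R - 5) * K = 0.
  move: R1; rewrite v2V -v1VK -v2K -v1K => /eqP.
  by rewrite -subr_eq0 => /eqP <-; ring.
move=> /eqP; rewrite mulf_eq0 (negPf K0) orbF subr_eq0 eqr_nat => /eqP p5.
by split.
Qed.

End Squarefree.

(** Only the constant -2 sits at the root 1, so the sum of v + 1/v over [s] is 2 - 2p. Each such
    term has absolute value at most 2. With p > 4 this excludes two or three terms all moving. *)
Lemma all_moving (p M : nat) (sg : nat -> {rmorphism algC -> algC})
    (s : seq (algC * algC)) : prime p -> (0 < M)%N ->
  (forall j v, (0 < j < p)%N -> v ^+ M = 1 -> sg j v = v) ->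
  (forall j z, (0 < j < p)%N -> z ^+ p = 1 -> sg j z = z ^+ j) ->
  (forall x, x \in s -> [/\ x.1 ^+ p = 1, x.1 != 1 & x.2 ^+ M = 1]) ->
  \sum_(x <- s) (x.1 * x.2 + x.1^-1 * x.2^-1) = 2 -> (p <= size s + 1)%N.
Proof.
move=> pp M0 sgv sgz sP rel.
pose s1 := (1, - 2) :: s ++ [seq (x.1^-1, x.2^-1) | x <- s].
have sp : all (fun x => x.1 ^+ p == 1) s1.
  rewrite /= expr1n eqxx all_cat all_map /=; apply/andP; split; apply/allP=> x /sP[xp _ _].
    exact/eqP.
  by rewrite /= exprVn xp invr1.
have sf j x : (0 < j < p)%N -> x \in s1 -> sg j x.2 = x.2.
  move=> jp; rewrite inE mem_cat => /or3P[/eqP->|/sP[_ _ xM]|/mapP[y /sP[_ _ yM] ->]] /=.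
  - by rewrite rmorphN rmorph_nat.
  - exact: sgv.
  - by rewrite fmorphV sgv.
have s0 : \sum_(x <- s1) x.1 * x.2 = 0.
  by rewrite big_cons big_cat big_map /= mul1r -big_split /= rel addNr.
have := squarefree_relation pp sgz sp sf s0 (expr1n _ _).
rewrite big_cons /= big_cat /= big_map /= -big_split /=.
rewrite [X in _ = _ * X]big_cons eqxx big_cat /= big_map /= [X in _ + (X + _)]big1_seq; last first.
  by move=> x /andP[/eqP x1 /sP[_]]; rewrite x1 eqxx.
rewrite [X in _ + (_ + X)]big1_seq; last first.
  by move=> x /andP[/eqP/(canRL invrK) x1 /sP[_]]; rewrite x1 invr1 eqxx.
rewrite !addr0 => /(canRL (addKr _)); rewrite opprK => sumE.
have : `|\sum_(x <- s) (x.2 + x.2^-1)| <= \sum_(x <- s) 2.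
  apply: le_trans (ler_norm_sum _ _ _) _; rewrite big_seq [leRHS]big_seq.
  by apply: ler_sum => x /sP[_ _ xM]; apply: twocos_norm_le M0 xM.
rewrite sumE big_const_seq count_predT iter_addr_0 -mulrnA.
have -> : 2 + p%:R * (- 2) = - (2 * p.-1)%:R :> algC.
  by rewrite -[p in LHS]prednK ?prime_gt0 // natrM -natr1; ring.
by rewrite normrN normr_nat ler_nat; have := prime_gt1 pp; lia.
Qed.

Lemma nonsquarefree_twocos (p M : nat) (s : seq algC) :
  prime p -> (p %| M)%N -> (0 < M)%N ->
  all (fun u => u ^+ (p * M) == 1) s -> \sum_(u <- s) twocos u = 2 ->
  \sum_(u <- s | u ^+ M == 1) twocos u = 2.
Proof.
move=> pp pM M0 sN rel.
(* The right-hand side 2 is written as the sum of the roots 1 and 1. *)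
have := @nonsquarefree_average p M (s ++ [seq u^-1 | u <- s]) [:: 1; 1] pp pM M0.
rewrite all_cat sN all_map /= expr1n eqxx; case: allP => [_|H]; last first.
  by case: H => u /(allP sN) /= uN; rewrite exprVn invr_eq1.
rewrite !big_cat !big_map !big_cons !big_nil !expr1n eqxx !addr0 /= -big_split /=.
move=> /(_ isT isT rel) e; rewrite -[RHS]/(1 + 1) -e big_split /=; congr (_ + _).
by apply: eq_bigl => u; rewrite exprVn invr_eq1.
Qed.

(** * Classification of the solutions with two and three terms *)

Lemma twocos_order6 (u : algC) : u ^+ 6 = 1 ->
  exists2 k : int, twocos u = k%:~R & k \in [:: 2; 1; -1; -2].
Proof.
move=> u6; have u0 : u != 0 by apply: unity_neq0 u6.
have : (u - 1) * ((u + 1) * ((u ^+ 2 + u + 1) * (u ^+ 2 - u + 1))) == 0.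
  apply/eqP; transitivity (u ^+ 6 - 1); [ring|by rewrite u6 subrr].
have tcE k : (twocos u = k%:~R) <-> (u ^+ 2 - k%:~R * u + 1 = 0).
  have -> : u ^+ 2 - k%:~R * u + 1 = (twocos u - k%:~R) * u.
    by rewrite /twocos; field.
  split=> [->|/eqP]; first by rewrite subrr mul0r.
  by rewrite mulf_eq0 (negPf u0) orbF subr_eq0 => /eqP.
rewrite !mulf_eq0 => /or4P[] /eqP e; [exists 2|exists (-2)|exists (-1)|exists 1] => //;
  apply/tcE.
- transitivity ((u - 1) * (u - 1)); [ring|by rewrite e mul0r].
- transitivity ((u + 1) * (u + 1)); [ring|by rewrite e mul0r].
- by rewrite -[RHS]e; ring.
- by rewrite -[RHS]e; ring.
Qed.

Lemma twocos_sum2 (u v : algC) n : (0 < n)%N -> u ^+ n = 1 -> v ^+ n = 1 ->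
  twocos u + twocos v = 2 ->
  [\/ twocos u = 2 /\ twocos v = 0, twocos u = 0 /\ twocos v = 2 |
      twocos u = 1 /\ twocos v = 1].
Proof.
move=> n0 un vn rel.
have sN : all (fun u => u ^+ n == 1) [:: u; v] by rewrite /= un vn eqxx.
case: (reduce_exponent n0 sN) => [[p [M [pp pM M0 + nM]]]|[p [M [pp p4 cpM M0 [+ nM]]]]|].
- move=> pMs; have := nonsquarefree_twocos pp pM M0 pMs.
  rewrite !big_cons !big_nil !addr0 => /(_ rel).
  move: nM; rewrite /= andbT; case: eqP => _; case: eqP => _ //= _.
  + rewrite addr0 => U; apply: Or31; split=> //.
    by move: rel; rewrite U => /(canRL (addKr _)); rewrite addNr.
  + move=> V; apply: Or32; split=> //.
    by move: rel; rewrite V => /(canRL (addrK _)); rewrite subrr.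
  + by move/esym/eqP; rewrite pnatr_eq0.
- rewrite /= andbT => /andP[/eqP uN /eqP vN].
  have [sg [sgv sgz]] := squarefree_auts pp cpM.
  have [z1 [v1 [uE z1p v1M z1M]]] := unity_split (prime_gt0 pp) M0 cpM uN.
  have [z2 [v2 [vE z2p v2M z2M]]] := unity_split (prime_gt0 pp) M0 cpM vN.
  move: nM; rewrite /= andbT -z1M -z2M.
  have [z1e|z11] := eqVneq z1 1; have [z2e|z21] := eqVneq z2 1 => //= _; exfalso.
  + move: rel; rewrite [twocos v](twocosZM vE) addrC => /(canRL (addrK _)).
    apply: (one_moving pp p4 M0 sgv sgz) => //.
    apply: fixedB; first exact: fixed_nat.
    by apply: (fixed_twocos sgv); rewrite uE z1e mul1r.
  + move: rel; rewrite [twocos u](twocosZM uE) => /(canRL (addrK _)).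
    apply: (one_moving pp p4 M0 sgv sgz) => //.
    apply: fixedB; first exact: fixed_nat.
    by apply: (fixed_twocos sgv); rewrite vE z2e mul1r.
  + have := @all_moving p M sg [:: (z1, v1); (z2, v2)] pp M0 sgv sgz.
    rewrite !big_cons big_nil /= addr0 -(twocosZM uE) -(twocosZM vE) rel.
    suff: forall x : algC * algC, x \in [:: (z1, v1); (z2, v2)] ->
        [/\ x.1 ^+ p = 1, x.1 != 1 & x.2 ^+ M = 1].
      by move=> H /(_ H erefl); lia.
    by move=> x; rewrite !inE => /orP[] /eqP->.
- rewrite /= andbT => /andP[/eqP /twocos_order6[k kE ks] /eqP /twocos_order6[l lE ls]].
  move: rel; rewrite kE lE -intrD => /(@intr_inj _ _ 2) kl.
  apply: Or33; move: ks ls; rewrite !inE => ks ls.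
  by have [-> ->] : k = 1 /\ l = 1 by lia.
Qed.

(** The first argument is the distinguished one. In the third kind, [twocos y] and [twocos z] are
    the golden ratio and its conjugate; fifth roots of unity encode them so that orders can be read
    off. *)
Definition twocos_solution (x y z : algC) : Prop :=
  [\/ twocos x = 2 /\ twocos y + twocos z = 0,
      [/\ twocos x = 0, twocos y = 1 & twocos z = 1] |
      twocos x = 1 /\ exists y' z' : algC,
       [/\ y = - y', z = - z', y' ^+ 5 = 1 /\ z' ^+ 5 = 1,
           y' != 1 /\ z' != 1 & y' != z' /\ y' * z' != 1]].

Lemma twocos_solutionC (x y z : algC) :
  twocos_solution x y z -> twocos_solution x z y.
Proof.
case=> [[X e]|[X Y Z]|[X [y' [z' [yE zE [y5 z5] [y1 z1] [ne nem]]]]]].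
- by apply: Or31; rewrite addrC.
- exact: Or32.
apply: Or33; split=> //; exists z', y'; split=> //.
by rewrite eq_sym mulrC.
Qed.

Lemma two_moving_solution (p M : nat) (x y z : algC) :
  prime p -> (4 < p)%N -> coprime p M -> (0 < M)%N ->
  x ^+ M = 1 -> y ^+ (p * M) = 1 -> z ^+ (p * M) = 1 ->
  y ^+ M != 1 -> z ^+ M != 1 -> twocos x + twocos y + twocos z = 2 ->
  twocos_solution x y z.
Proof.
move=> pp p4 cpM M0 xM yN zN yM zM rel.
have [sg [sgv sgz]] := squarefree_auts pp cpM.
have [z1 [v1 [yE z1p v1M z1M]]] := unity_split (prime_gt0 pp) M0 cpM yN.
have [z2 [v2 [zE z2p v2M z2M]]] := unity_split (prime_gt0 pp) M0 cpM zN.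
rewrite -z1M in yM; rewrite -z2M in zM.
pose K := 2 - twocos x.
have relK : twocos y + twocos z = K by rewrite /K -rel; ring.
have fK : forall j, (0 < j < p)%N -> sg j K = K.
  by apply: fixedB; [exact: fixed_nat|exact: (fixed_twocos sgv)].
have := relK; rewrite (twocosZM yE) (twocosZM zE).
case/(two_moving pp p4 M0 sgv sgz z1p yM v1M z2p zM v2M fK) => [K0|].
  apply: Or31; split; last by rewrite relK.
  by apply/esym/eqP; rewrite -subr_eq0 -/K K0.
move=> [[p5 ne nem v1K v2K] /eqP]; rewrite sqrf_eq1 => /orP[]/eqP K1.
  have xE : twocos x = 1.
    by have -> : twocos x = 2 - K; [rewrite /K; ring|rewrite K1; ring].
  apply: Or33; split=> //; exists z1, z2; rewrite -p5; split=> //.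
    by rewrite yE v1K K1 mulrN1.
  by rewrite zE v2K K1 mulrN1.
(* The remaining value K = -1 would give [twocos x] = 3, above the bound 2. *)
have := twocos_norm_le M0 xM.
have -> : twocos x = 3%:R by rewrite -[twocos x](subKr 2) -/K K1; ring.
by rewrite normr_nat ler_nat.
Qed.

(** When p divides M, the terms surviving the average sum to 2: a single survivor has value 2, and
    two fall under [twocos_sum2]. When p is prime to M, exactly two terms move. For exponent 6,
    three values among 2, 1, -1, -2 with sum 2 include a 2. *)
Lemma twocos_sum3 (x y z : algC) n : (0 < n)%N ->
  x ^+ n = 1 -> y ^+ n = 1 -> z ^+ n = 1 ->
  twocos x + twocos y + twocos z = 2 ->
  [\/ twocos_solution x y z, twocos_solution y x z | twocos_solution z x y].
Proof.
move=> n0 xn yn zn rel.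
have sN : all (fun u => u ^+ n == 1) [:: x; y; z] by rewrite /= xn yn zn eqxx.
have perm1 : twocos y + twocos x + twocos z = 2 by rewrite -rel; ring.
have perm2 : twocos z + twocos x + twocos y = 2 by rewrite -rel; ring.
have solA u v w : twocos u + twocos v + twocos w = 2 -> twocos u = 2 ->
    twocos_solution u v w.
  move=> e U; apply: Or31; split=> //; move: e; rewrite U -addrA => /(canRL (addKr _)).
  by rewrite addNr.
(* Two terms that already sum to 2 leave the value 0 for the third. *)
have solB u v w : u ^+ n = 1 -> v ^+ n = 1 -> w ^+ n = 1 ->
    twocos u + twocos v + twocos w = 2 -> twocos v + twocos w = 2 ->
    [\/ twocos_solution u v w, twocos_solution v u w | twocos_solution w u v].
  move=> un vn wn e e'.
  have U : twocos u = 0.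
    by move: e; rewrite -addrA e' => /(canRL (addrK _)); rewrite subrr.
  case: (twocos_sum2 n0 vn wn e') => [[V W]|[V W]|[V W]].
  - by apply: Or32; apply: solA => //; rewrite U V W; ring.
  - by apply: Or33; apply: solA => //; rewrite U V W; ring.
  - by apply: Or31; apply: Or32.
case: (reduce_exponent n0 sN) => [[p [M [pp pM M0 + nM]]]|[p [M [pp p4 cpM M0 [+ nM]]]]|].
- move=> pMs; have := nonsquarefree_twocos pp pM M0 pMs.
  rewrite !big_cons !big_nil !addr0 addrA => /(_ rel).
  move: nM; rewrite /= andbT; case: eqP => _; case: eqP => _; case: eqP => _ //= _;
    rewrite ?addr0.
  + by move=> e; have [] := solB z x y zn xn yn perm2 e;
      [exact: Or33|move/twocos_solutionC; exact: Or31|move/twocos_solutionC; exact: Or32].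
  + by move=> e; have [] := solB y x z yn xn zn perm1 e;
      [exact: Or32|exact: Or31|move/twocos_solutionC; exact: Or33].
  + by move=> e; apply: Or31; exact: solA.
  + by move=> e; exact: solB.
  + by move=> e; apply: Or32; exact: solA.
  + by move=> e; apply: Or33; exact: solA.
  + by move/esym/eqP; rewrite pnatr_eq0.
- rewrite /= andbT => /and3P[/eqP xN /eqP yN /eqP zN].
  move: nM; rewrite /= andbT.
  have solC u v w : u ^+ (p * M) = 1 -> u ^+ M != 1 -> v ^+ M = 1 -> w ^+ M = 1 ->
      twocos u + twocos v + twocos w = 2 -> False.
    move=> uN uM vM wM; have [sg [sgv sgz]] := squarefree_auts pp cpM.
    have [z1 [v1 [uE z1p v1M z1M]]] := unity_split (prime_gt0 pp) M0 cpM uN.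
    rewrite -z1M in uM; rewrite (twocosZM uE) -addrA => /(canRL (addrK _)).
    apply: (one_moving pp p4 M0 sgv sgz) => //.
    rewrite opprD addrA.
    apply: fixedB; last exact: (fixed_twocos sgv).
    by apply: fixedB; [exact: fixed_nat|exact: (fixed_twocos sgv)].
  have [xM|xM] := eqVneq (x ^+ M) 1; have [yM|yM] := eqVneq (y ^+ M) 1;
    have [zM|zM] := eqVneq (z ^+ M) 1 => //= _.
  + by case: (solC z x y).
  + by case: (solC y x z).
  + by apply: Or31; apply: (two_moving_solution pp p4 cpM M0).
  + by case: (solC x y z).
  + by apply: Or32; apply: (two_moving_solution pp p4 cpM M0).
  + by apply: Or33; apply: (two_moving_solution pp p4 cpM M0).
  + exfalso; have [sg [sgv sgz]] := squarefree_auts pp cpM.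
    have [z1 [v1 [xE z1p v1M z1M]]] := unity_split (prime_gt0 pp) M0 cpM xN.
    have [z2 [v2 [yE z2p v2M z2M]]] := unity_split (prime_gt0 pp) M0 cpM yN.
    have [z3 [v3 [zE z3p v3M z3M]]] := unity_split (prime_gt0 pp) M0 cpM zN.
    rewrite -z1M in xM; rewrite -z2M in yM; rewrite -z3M in zM.
    have := @all_moving p M sg [:: (z1, v1); (z2, v2); (z3, v3)] pp M0 sgv sgz.
    rewrite !big_cons big_nil /= addr0 -(twocosZM xE) -(twocosZM yE) -(twocosZM zE).
    rewrite addrA rel.
    suff: forall x : algC * algC, x \in [:: (z1, v1); (z2, v2); (z3, v3)] ->
        [/\ x.1 ^+ p = 1, x.1 != 1 & x.2 ^+ M = 1].
      by move=> H /(_ H erefl); lia.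
    by move=> t; rewrite !inE => /or3P[] /eqP->.
- rewrite /= andbT => /and3P[/eqP /twocos_order6[k kE ks]].
  move=> /eqP /twocos_order6[l lE ls] /eqP /twocos_order6[i iE is_].
  have := rel; rewrite kE lE iE -!intrD => /(@intr_inj _ _ 2) kl.
  move: ks ls is_; rewrite !inE => ks ls is_.
  have [k2|[l2|i2]] : k = 2 \/ l = 2 \/ i = 2 by lia.
  + by apply: Or31; apply: solA rel _; rewrite kE k2.
  + by apply: Or32; apply: solA perm1 _; rewrite lE l2.
  + by apply: Or33; apply: solA perm2 _; rewrite iE i2.
Qed.

(** * From solutions to congruences on the exponents *)

Lemma expz_eq1 (z : algC) n (k : int) : n.-primitive_root z ->
  (z ^ k == 1) = (n %| k)%Z.
Proof.
move=> zp; case: k => k; first by rewrite dvdzE (prim_order_dvd zp).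
by rewrite dvdzE (prim_order_dvd zp) NegzE -invr_expz invr_eq1.
Qed.

Lemma twocos_eq (u v : algC) : u != 0 -> v != 0 ->
  (twocos u == twocos v) = (u == v) || (u * v == 1).
Proof.
move=> u0 v0; have e : (u - v) * (u * v - 1) = (twocos u - twocos v) * (u * v).
  by rewrite /twocos; field; rewrite u0 v0.
rewrite -[u == v]subr_eq0 -[_ == 1]subr_eq0 -mulf_eq0 e.
by rewrite !mulf_eq0 (negPf u0) (negPf v0) !orbF subr_eq0.
Qed.

Lemma twocosN (u : algC) : twocos (- u) = - twocos u.
Proof. by rewrite /twocos invrN opprD. Qed.

Lemma twocos1 : twocos 1 = 2.
Proof. by rewrite /twocos invr1. Qed.

Lemma twocos_eq2 (u : algC) : u != 0 -> twocos u = 2 -> u = 1.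
Proof.
move=> u0 /eqP; rewrite -twocos1 twocos_eq ?oner_eq0 // mulr1 orbb.
by move/eqP.
Qed.

Lemma neg1_neq1 : (-1 == 1 :> algC) = false.
Proof.
by rewrite eq_sym -addr_eq0 -[1 + 1]/(2%:R) pnatr_eq0.
Qed.

Section PrimitiveRoot.
Variables (n : nat) (z : algC).
Hypothesis zp : n.-primitive_root z.

Let z0 : z != 0.
Proof. exact: unity_neq0 (prim_order_gt0 zp) (prim_expr_order zp). Qed.

Let dvd_expn (k : int) (j : nat) : (n %| j%:Z * k)%Z = ((z ^ k) ^+ j == 1).
Proof. by rewrite -(expz_eq1 _ zp) mulrC -exprz_exp. Qed.

(** Such a z^k is a root of u^2 - u + 1, hence of order 6. Here and below, orders are expressed by
    divisibilities, which linear arithmetic can treat once n is known. *)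
Lemma twocos_prim1 k : twocos (z ^ k) = 1 ->
  [/\ (n %| 6 * k)%Z, ~~ (n %| 2 * k)%Z & ~~ (n %| 3 * k)%Z].
Proof.
have u0 := expfz_neq0 k z0; rewrite !dvd_expn; move: (z ^ k) u0 => u u0 U.
have u2 : u ^+ 2 = u - 1.
  apply/eqP; rewrite -subr_eq0; apply/eqP.
  transitivity (u * (twocos u - 1)); first by rewrite /twocos; field.
  by rewrite U subrr mulr0.
have u3 : u ^+ 3 = -1 by rewrite exprS u2 mulrBr -expr2 u2; ring.
rewrite (exprM u 3 2) u3 sqrrN expr1n neg1_neq1; split=> //; rewrite u2; apply/negP => /eqP u1.
have ue : u = 2 by rewrite -[u](subrK 1) u1.
by move/eqP: u2; rewrite ue -subr_eq0 (_ : _ - _ = 3%:R) ?pnatr_eq0 //; ring.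
Qed.

Lemma twocos_prim0 k : twocos (z ^ k) = 0 ->
  (n %| 4 * k)%Z /\ ~~ (n %| 2 * k)%Z.
Proof.
have u0 := expfz_neq0 k z0; rewrite !dvd_expn; move: (z ^ k) u0 => u u0 U.
have u2 : u ^+ 2 = -1.
  apply/eqP; rewrite -subr_eq0 opprK; apply/eqP.
  by transitivity (u * twocos u); [rewrite /twocos; field|rewrite U mulr0].
by rewrite (exprM u 2 2) u2 sqrrN expr1n neg1_neq1.
Qed.

Lemma twocos_primN1 k : twocos (z ^ k) = -1 ->
  (n %| 3 * k)%Z /\ ~~ (n %| k)%Z.
Proof.
rewrite -[X in ~~ (_ %| X)%Z]mul1r.
have u0 := expfz_neq0 k z0; rewrite !dvd_expn; move: (z ^ k) u0 => u u0 U.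
have u2 : u ^+ 2 + u + 1 = 0.
  transitivity (u * (twocos u + 1)); first by rewrite /twocos; field.
  by rewrite U addNr mulr0.
split; last first.
  rewrite expr1; apply: contra_eq_neq u2 => ->.
  by rewrite (_ : _ + 1 = 3%:R) ?pnatr_eq0 //; ring.
rewrite -subr_eq0; apply/eqP; transitivity ((u - 1) * (u ^+ 2 + u + 1)).
  by ring.
by rewrite u2 mulr0.
Qed.

Lemma expz_prim5 k : (z ^ k) ^+ 5 = 1 -> z ^ k != 1 ->
  (n %| 5 * k)%Z /\ ~~ (n %| k)%Z.
Proof. by rewrite dvd_expn => -> z1; rewrite -(expz_eq1 _ zp). Qed.

Lemma expz_prim10 k : (- z ^ k) ^+ 5 = 1 -> - z ^ k != 1 ->
  [/\ (n %| 10 * k)%Z, ~~ (n %| 5 * k)%Z & ~~ (n %| 2 * k)%Z].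
Proof.
rewrite !dvd_expn; move: (z ^ k) => u; rewrite exprNn -signr_odd /= expr1 mulN1r.
move=> /(canRL opprK) u5 u1.
rewrite (exprM u 5 2) u5 sqrrN expr1n neg1_neq1; split=> //.
rewrite sqrf_eq1 negb_or -[u == -1]eqr_oppLR u1 andbT.
by apply: contra_eq_neq u5 => ->; rewrite expr1n eq_sym neg1_neq1.
Qed.

End PrimitiveRoot.

Lemma dvdn12_cases n : (n %| 12)%N -> n \in [:: 1; 2; 3; 4; 6; 12]%N.
Proof. by rewrite dvdn_divisors. Qed.

Lemma dvdn30_cases n : (n %| 30)%N -> n \in [:: 1; 2; 3; 5; 6; 10; 15; 30]%N.
Proof. by rewrite dvdn_divisors. Qed.

Lemma orders_6_6_4_mod12 (n : nat) (p q c : int) : (n %| 12)%N ->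
  (n %| 6 * p)%Z -> ~~ (n %| 2 * p)%Z -> ~~ (n %| 3 * p)%Z ->
  (n %| 6 * q)%Z -> ~~ (n %| 2 * q)%Z -> ~~ (n %| 3 * q)%Z ->
  (n %| 4 * c)%Z -> ~~ (n %| 2 * c)%Z ->
  n = 12%N /\ [/\ eqpm_mod 12 p 2, eqpm_mod 12 q 2 & eqpm_mod 12 c 3].
Proof.
move=> /dvdn12_cases; rewrite /eqpm_mod !inE.
case/or4P=> [|||/or3P[||]] /eqP-> *; split; do ?split; lia.
Qed.

(** Orders 4 and 6 force n = 12, so p is 3 or -3 and q is 2 or -2 mod 12, of opposite parities.
    Hence a value 0 can come only from the exponent c. *)
Lemma orders_4_6_3_parity (n : nat) (p q c : int) : (n %| 12)%N -> (2 %| p - q)%Z ->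
  (n %| 4 * p)%Z -> ~~ (n %| 2 * p)%Z ->
  (n %| 6 * q)%Z -> ~~ (n %| 2 * q)%Z -> ~~ (n %| 3 * q)%Z ->
  (n %| 3 * c)%Z -> ~~ (n %| c)%Z -> False.
Proof.
move=> /dvdn12_cases; rewrite !inE.
case/or4P=> [|||/or3P[||]] /eqP-> *; lia.
Qed.

(** This and the next three lemmas list the residues mod 30 of additive order 6, 10, 5 and 3. *)
Lemma order6_mod30 (n : nat) (p : int) : (n %| 30)%N ->
  (n %| 6 * p)%Z -> ~~ (n %| 2 * p)%Z -> ~~ (n %| 3 * p)%Z ->
  (6 %| n)%N /\ (n = 30%N -> eqpm_mod 30 p 5).
Proof.
move=> /dvdn30_cases; rewrite /eqpm_mod !inE.
case/or4P=> [|||/or4P[|||/orP[|]]] /eqP-> *; split; lia.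
Qed.

Lemma order10_mod30 (n : nat) (p : int) : (n %| 30)%N ->
  (n %| 10 * p)%Z -> ~~ (n %| 5 * p)%Z -> ~~ (n %| 2 * p)%Z ->
  (10 %| n)%N /\ (n = 30%N -> eqpm_mod 30 p 3 || eqpm_mod 30 p 9).
Proof.
move=> /dvdn30_cases; rewrite /eqpm_mod !inE.
case/or4P=> [|||/or4P[|||/orP[|]]] /eqP-> *; split; lia.
Qed.

Lemma order5_mod30 (n : nat) (p : int) : (n %| 30)%N ->
  (n %| 5 * p)%Z -> ~~ (n %| p)%Z ->
  (5 %| n)%N /\ (n = 30%N -> eqpm_mod 30 p 6 || eqpm_mod 30 p 12).
Proof.
move=> /dvdn30_cases; rewrite /eqpm_mod !inE.
case/or4P=> [|||/or4P[|||/orP[|]]] /eqP-> *; split; lia.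
Qed.

Lemma order3_mod30 (n : nat) (p : int) : (n %| 30)%N ->
  (n %| 3 * p)%Z -> ~~ (n %| p)%Z ->
  (3 %| n)%N /\ (n = 30%N -> eqpm_mod 30 p 10).
Proof.
move=> /dvdn30_cases; rewrite /eqpm_mod !inE.
case/or4P=> [|||/or4P[|||/orP[|]]] /eqP-> *; split; lia.
Qed.

Lemma eqpm_modP (n : nat) (x k : int) : eqpm_mod n x k ->
  exists y : int, x = n%:Z * y + k \/ x = n%:Z * y - k.
Proof.
rewrite /eqpm_mod !eqz_mod_dvd => /orP[] /dvdzP[y e]; exists y; [left|right]; lia.
Qed.

(** Up to sign, 6q is 12 mod 30 when q is 3, and 6 when q is 9. The last two hypotheses thus rule
    out the pairs (3, 12) and (9, 6) for (q, c). *)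
Lemma orders_6_10_5_mod30 (n : nat) (p q c : int) : (n %| 30)%N ->
  (n %| 6 * p)%Z -> ~~ (n %| 2 * p)%Z -> ~~ (n %| 3 * p)%Z ->
  (n %| 10 * q)%Z -> ~~ (n %| 5 * q)%Z -> ~~ (n %| 2 * q)%Z ->
  (n %| 5 * c)%Z -> ~~ (n %| c)%Z ->
  ~~ (n %| 6 * q - c)%Z -> ~~ (n %| 6 * q + c)%Z ->
  [/\ n = 30%N, eqpm_mod 30 p 5 &
      (eqpm_mod 30 q 3 /\ eqpm_mod 30 c 6) \/
      (eqpm_mod 30 q 9 /\ eqpm_mod 30 c 12)].
Proof.
move=> n30 p6 p2 p3 q10 q5 q2 c5 c1 d1 d2.
have [n6 P] := order6_mod30 n30 p6 p2 p3.
have [n10 Q] := order10_mod30 n30 q10 q5 q2.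
have [n5 C] := order5_mod30 n30 c5 c1.
have n30E : n = 30%N.
  by move: (dvdn30_cases n30) n6 n5; rewrite !inE; case/or4P=> [|||/or4P[|||/orP[|]]] /eqP->.
split; [by []|exact: P|].
rewrite n30E in d1 d2.
case/orP: (Q n30E) => Q1; case/orP: (C n30E) => C1; [by left| | |by right]; exfalso;
 case: (eqpm_modP Q1) => x qE; case: (eqpm_modP C1) => y cE;
 case: qE d1 d2 => ->; case: cE => ->; clear; lia.
Qed.

Lemma orders_10_10_3_mod30 (n : nat) (p q c : int) : (n %| 30)%N ->
  (n %| 10 * p)%Z -> ~~ (n %| 5 * p)%Z -> ~~ (n %| 2 * p)%Z ->
  (n %| 10 * q)%Z -> ~~ (n %| 5 * q)%Z -> ~~ (n %| 2 * q)%Z ->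
  (n %| 3 * c)%Z -> ~~ (n %| c)%Z ->
  ~~ (n %| p - q)%Z -> ~~ (n %| p + q)%Z ->
  [/\ n = 30%N, one_other_mod 30 p q 3 9 & eqpm_mod 30 c 10].
Proof.
move=> n30 p10 p5 p2 q10 q5 q2 c3 c1 d1 d2.
have [n10 P] := order10_mod30 n30 p10 p5 p2.
have [_ Q] := order10_mod30 n30 q10 q5 q2.
have [n3 C] := order3_mod30 n30 c3 c1.
have n30E : n = 30%N.
  by move: (dvdn30_cases n30) n10 n3; rewrite !inE; case/or4P=> [|||/or4P[|||/orP[|]]] /eqP->.
split; [by []| |exact: C].
rewrite n30E in d1 d2; rewrite /one_other_mod.
case/orP: (P n30E) => P1; case/orP: (Q n30E) => Q1; rewrite ?P1 ?Q1 ?orbT //; exfalso;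
 case: (eqpm_modP P1) => x pE; case: (eqpm_modP Q1) => y qE;
 case: pE d1 d2 => ->; case: qE => ->; clear; lia.
Qed.

(** The divisibilities give n | k gcd(p, q, c), and n is prime to this gcd. This bounds n by a
    common multiple of the orders of z^p, z^q and z^c. *)
Lemma dvdn_of_primitive (n k : nat) (p q c : int) :
  (forall d : nat, (d %| n)%N -> (d %| p)%Z -> (d %| q)%Z -> (d %| c)%Z -> d = 1%N) ->
  (n %| k%:Z * p)%Z -> (n %| k%:Z * q)%Z -> (n %| k%:Z * c)%Z -> (n %| k)%N.
Proof.
rewrite !dvdzE !abszM !absz_nat => prim np nq nc.
have := conj np (conj nq nc).
have -> : (n %| k * `|p|)%N /\ (n %| k * `|q|)%N /\ (n %| k * `|c|)%N <->
    (n %| k * gcdn `|p| (gcdn `|q| `|c|))%N.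
  rewrite !muln_gcdr !dvdn_gcd; split=> [[-> [-> ->]]|/and3P[]] //.
rewrite Gauss_dvdl //; apply/eqP.
apply: prim; first exact: dvdn_gcdl;
  rewrite dvdzE; apply: dvdn_trans (dvdn_gcdr _ _) _; first exact: dvdn_gcdl.
  exact: dvdn_trans (dvdn_gcdr _ _) (dvdn_gcdl _ _).
exact: dvdn_trans (dvdn_gcdr _ _) (dvdn_gcdr _ _).
Qed.

Lemma dvdz_mulW (l : int) (n k k' : int) (x : int) : (n %| k * x)%Z ->
  k' = l * k -> (n %| k' * x)%Z.
Proof. by move=> nk ->; rewrite -mulrA dvdz_mull. Qed.

Section PrimitiveExponents.
Variables (n : nat) (z : algC) (p q c : int).
Hypothesis zp : n.-primitive_root z.
Hypothesis prim : forall d : nat,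
  (d %| n)%N -> (d %| p)%Z -> (d %| q)%Z -> (d %| c)%Z -> d = 1%N.

Let z0 : z != 0.
Proof. exact: unity_neq0 (prim_order_gt0 zp) (prim_expr_order zp). Qed.

Let zk0 (k : int) : z ^ k != 0 := expfz_neq0 k z0.

Let expzB k l : z ^ (k - l) = z ^ k / z ^ l.
Proof. by rewrite expfzDr // invr_expz. Qed.

Lemma expz_eqN1 k : z ^ k = -1 -> (n %| 2 * k)%Z /\ ~~ (n %| k)%Z.
Proof.
move=> zk; rewrite -!(expz_eq1 _ zp) zk neg1_neq1; split=> //.
by rewrite mulrC -exprz_exp zk -[_ ^ 2]/((-1) ^+ 2) sqrrN expr1n.
Qed.

(** With z^p distinguished, the first kind of solution leads to condition (i), parity excludes the
    second, and the third leads to the two clauses of (iv) that involve 5. *)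
Lemma solution_exponent_p : (2 %| p - q)%Z ->
  twocos_solution (z ^ p) (z ^ q) (- z ^ c) ->
  ((n %| p)%Z /\ ((n %| q - c)%Z \/ (n %| q + c)%Z)) \/
  [/\ n = 30%N, eqpm_mod 30 p 5 &
      (eqpm_mod 30 q 3 /\ eqpm_mod 30 c 6) \/
      (eqpm_mod 30 q 9 /\ eqpm_mod 30 c 12)].
Proof.
move=> par [[U VW]|[U V W]|[U [y' [z' [vE wE [y5 z5] [y1 z1] [ne nem]]]]]].
- left; split; first by rewrite -(expz_eq1 _ zp) (twocos_eq2 (zk0 p) U).
  have /eqP : twocos (z ^ q) = twocos (z ^ c).
    by move/eqP: VW; rewrite twocosN subr_eq0 => /eqP.
  rewrite twocos_eq // -!(expz_eq1 _ zp) expzB expfzDr //.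
  case/orP=> [/eqP->|->]; last by right.
  by left; rewrite divff.
- have [p4 p2] := twocos_prim0 zp U; have [q6 q2 q3] := twocos_prim1 zp V.
  have [c3 c1] : (n %| 3 * c)%Z /\ ~~ (n %| c)%Z.
    by apply: (twocos_primN1 zp); rewrite -[twocos _]opprK -twocosN W.
  have n12 : (n %| 12)%N.
    by apply: (dvdn_of_primitive prim);
      [apply: (dvdz_mulW (l := 3) p4)|apply: (dvdz_mulW (l := 2) q6)|apply: (dvdz_mulW (l := 4) c3)].
  by case: (orders_4_6_3_parity n12 par p4 p2 q6 q2 q3 c3 c1).
have [p6 p2 p3] := twocos_prim1 zp U.
have y'E : y' = - z ^ q by rewrite vE opprK.
have z'E : z' = z ^ c by apply/oppr_inj; rewrite -wE.
rewrite y'E in y5 y1 ne nem; rewrite z'E in z5 z1 ne nem.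
have [q10 q5 q2] := expz_prim10 zp y5 y1.
have [c5 c1] := expz_prim5 zp z5 z1.
(* So y' is z^(6q), and the inequalities between y', z' and their inverses become statements about
   6q - c and 6q + c. *)
have y6 : z ^ (6 * q) = - z ^ q.
  rewrite mulrC -exprz_exp -[LHS]/((z ^ q) ^+ 6) exprSr.
  by move/eqP: y5; rewrite exprNn -signr_odd /= mulN1r eqr_oppLR => /eqP ->; rewrite mulN1r.
right; apply: orders_6_10_5_mod30 => //; last 2 first.
- by rewrite -(expz_eq1 _ zp) expzB y6 -[1](divff (zk0 c)) (inj_eq (mulIf (invr_neq0 (zk0 c)))).
- by rewrite -(expz_eq1 _ zp) expfzDr // y6.
by apply: (dvdn_of_primitive prim);
  [apply: (dvdz_mulW (l := 5) p6)|apply: (dvdz_mulW (l := 3) q10)|apply: (dvdz_mulW (l := 6) c5)].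
Qed.

(** In the first kind z^c = -1 and one of z^(p-q), z^(p+q) is -1, the source of condition (ii). The
    other kinds lead to (iii) and to the clause of (iv) with 3 and 9. *)
Lemma solution_exponent_c : twocos_solution (- z ^ c) (z ^ p) (z ^ q) ->
  [\/ [/\ (n %| 2 * c)%Z, ~~ (n %| c)%Z &
         ((n %| 2 * (p - q))%Z /\ ~~ (n %| p - q)%Z) \/
         ((n %| 2 * (p + q))%Z /\ ~~ (n %| p + q)%Z)],
      n = 12%N /\ [/\ eqpm_mod 12 p 2, eqpm_mod 12 q 2 & eqpm_mod 12 c 3] |
      [/\ n = 30%N, one_other_mod 30 p q 3 9 & eqpm_mod 30 c 10]].
Proof.
case=> [[W UV]|[W U V]|[W [y' [z' [uE vE [y5 z5] [y1 z1] [ne nem]]]]]].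
- have w1 : z ^ c = -1.
    by rewrite -(twocos_eq2 _ W) ?opprK ?oppr_eq0.
  have [c2 c1] := expz_eqN1 w1; apply: Or31; split=> //.
  have /eqP : twocos (z ^ p) = twocos (- z ^ q).
    by rewrite twocosN; apply/eqP; rewrite -addr_eq0 UV.
  rewrite twocos_eq ?oppr_eq0 // => /orP[/eqP uE|/eqP uvE].
    left; apply: expz_eqN1; rewrite expzB uE mulNr divff //.
  right; apply: expz_eqN1; rewrite expfzDr //.
  by apply/oppr_inj; rewrite -mulrN uvE opprK.
- have [p6 p2 p3] := twocos_prim1 zp U; have [q6 q2 q3] := twocos_prim1 zp V.
  have [c4 c2] : (n %| 4 * c)%Z /\ ~~ (n %| 2 * c)%Z.
    by apply: (twocos_prim0 zp); rewrite -[twocos _]opprK -twocosN W oppr0.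
  apply: Or32; apply: orders_6_6_4_mod12 => //; apply: (dvdn_of_primitive prim);
  by [apply: (dvdz_mulW (l := 2) p6)|apply: (dvdz_mulW (l := 2) q6)|apply: (dvdz_mulW (l := 3) c4)].
have [c3 c1] : (n %| 3 * c)%Z /\ ~~ (n %| c)%Z.
  by apply: (twocos_primN1 zp); rewrite -[twocos _]opprK -twocosN W.
have y'E : y' = - z ^ p by rewrite uE opprK.
have z'E : z' = - z ^ q by rewrite vE opprK.
rewrite y'E in y5 y1 ne nem; rewrite z'E in z5 z1 ne nem.
have [p10 p5 p2] := expz_prim10 zp y5 y1.
have [q10 q5 q2] := expz_prim10 zp z5 z1.
apply: Or33; apply: orders_10_10_3_mod30 => //; last 2 first.
- rewrite -(expz_eq1 _ zp) expzB -[1](divff (zk0 q)).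
  by rewrite (inj_eq (mulIf (invr_neq0 (zk0 q)))) -(inj_eq oppr_inj).
- by rewrite -(expz_eq1 _ zp) expfzDr // -mulrNN.
by apply: (dvdn_of_primitive prim);
  [apply: (dvdz_mulW (l := 3) p10)|apply: (dvdz_mulW (l := 3) q10)|apply: (dvdz_mulW (l := 10) c3)].
Qed.

End PrimitiveExponents.

(** * Valuations, gcds, and values at roots of order 12 and 30 *)

Lemma v2_half (n : nat) (c : int) : c != 0 -> (n %| 2 * c)%Z -> ~~ (n %| c)%Z ->
  logn 2 n = (v2 c).+1.
Proof.
rewrite /v2 !dvdzE abszM /= -absz_gt0; move: `|c|%N => {}c c0 /dvdnP[k kE] nc.
have n0 : (0 < n)%N by move: kE; case: n nc => //; lia.
(* In 2c = kn an even k would give n | c; with k odd, n and 2c have the same 2-part. *)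
have kodd : odd k.
  apply: contraR nc; rewrite -dvdn2 => /dvdnP[l kl].
  by apply/dvdnP; exists l; move: kE; rewrite kl; lia.
have k0 : (0 < k)%N by case: k kodd {kE}.
have := congr1 (logn 2) kE.
by rewrite !lognM // logn_prime // (@lognE 2 k) dvdn2 kodd !andbF add0n => <-.
Qed.

Lemma coprimez_gcdP (m : nat) (x y : int) : reflect
  (forall d : nat, (d %| m)%N -> (d %| x)%Z -> (d %| y)%Z -> d = 1%N)
  (coprimez m (gcdz x y)).
Proof.
apply: (iffP idP) => [co d dm dx dy|H].
  have : (d %| gcdz m (gcdz x y))%Z by rewrite !dvdz_gcd dx dy !andbT.
  by rewrite (eqP co) dvdzE dvdn1 => /eqP.
apply/eqP; rewrite /gcdz /=; congr Posz; apply: H; first exact: dvdn_gcdl.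
  by rewrite dvdzE; apply: dvdn_trans (dvdn_gcdr _ _) (dvdn_gcdl _ _).
by rewrite dvdzE; apply: dvdn_trans (dvdn_gcdr _ _) (dvdn_gcdr _ _).
Qed.

Lemma prim_root_half k (z : algC) : (k.*2).-primitive_root z -> z ^+ k = -1.
Proof.
move=> zp; have k0 := prim_order_gt0 zp.
have /eqP : (z ^+ k) ^+ 2 = 1 by rewrite -exprM muln2 (prim_expr_order zp).
rewrite sqrf_eq1 -(prim_order_dvd zp) gtnNdvd //=; first by move/eqP.
all: lia.
Qed.

Lemma expz_v2 (z : algC) k (x : int) : (2 ^ k.+1).-primitive_root z ->
  x != 0 -> v2 x = k -> z ^ x = -1.
Proof.
move=> zp x0 vx.
have /eqP : (z ^ x) ^+ 2 = 1.
  apply/eqP; rewrite -[_ ^+ 2]/((z ^ x) ^ 2%:Z) exprz_exp (expz_eq1 _ zp) dvdzE abszM.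
  rewrite expnSr dvdn_pmul2r // pfactor_dvdn ?absz_gt0 //.
  by rewrite -vx.
rewrite sqrf_eq1 (expz_eq1 _ zp) dvdzE pfactor_dvdn ?absz_gt0 //=.
by rewrite -[logn _ _]/(v2 x) vx ltnn /= => /eqP.
Qed.

Lemma twocos_eqpm (z : algC) n (x k : int) : n.-primitive_root z ->
  eqpm_mod n x k -> twocos (z ^ x) = twocos (z ^ k).
Proof.
move=> zp; have n0 := prim_order_gt0 zp; have zn := prim_expr_order zp.
case/orP=> /eqP e; rewrite (expz_eqmod n0 zn e) //.
by rewrite -invr_expz twocosV.
Qed.

Lemma twocos_one_other (z : algC) n (x y k l : int) : n.-primitive_root z ->
  one_other_mod n x y k l ->
  twocos (z ^ x) + twocos (z ^ y) = twocos (z ^ k) + twocos (z ^ l).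
Proof.
move=> zp /orP[] /andP[xk yl].
  by rewrite (twocos_eqpm zp xk) (twocos_eqpm zp yl).
by rewrite (twocos_eqpm zp xk) (twocos_eqpm zp yl) addrC.
Qed.

Lemma twocosX2 (z : algC) : z != 0 -> twocos (z ^+ 2) = twocos z ^+ 2 - 2.
Proof. by move=> z0; rewrite /twocos; field. Qed.

Lemma twocosX3 (z : algC) : z != 0 -> twocos (z ^+ 3) = twocos z ^+ 3 - 3 * twocos z.
Proof. by move=> z0; rewrite /twocos; field. Qed.

(** Rests on z^6 + 1 = (z^2 + 1)(z^4 - z^2 + 1), whose first factor is nonzero. *)
Lemma twocos12 (z : algC) : 12.-primitive_root z ->
  twocos (z ^+ 2) = 1 /\ twocos (z ^+ 3) = 0.
Proof.
move=> zp; have z0 : z != 0 by apply: unity_neq0 (prim_expr_order zp).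
have z6 : z ^+ 6 = -1 := prim_root_half (k := 6) zp.
have z4 : z ^+ 4 != 1 by rewrite -(prim_order_dvd zp).
have e2 : z ^+ 4 - z ^+ 2 + 1 = 0.
  have /eqP : (z ^+ 2 + 1) * (z ^+ 4 - z ^+ 2 + 1) = 0.
    by transitivity (z ^+ 6 + 1); [ring|rewrite z6 addNr].
  rewrite mulf_eq0 => /orP[|/eqP //]; rewrite addr_eq0 => /eqP z2.
  by case/negP: z4; rewrite (exprM z 2 2) z2 sqrrN expr1n.
split; apply/eqP.
  rewrite -subr_eq0 -(mulIr_eq0 _ (mulIf (expf_neq0 2 z0))); apply/eqP.
  by rewrite -[RHS]e2 /twocos; field.
rewrite -(mulIr_eq0 _ (mulIf (expf_neq0 3 z0))); apply/eqP.
by transitivity (z ^+ 6 + 1); [rewrite /twocos; field|rewrite z6 addNr].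
Qed.

(** As z^3 has order 10, g is the golden ratio or its conjugate. The values at 6, 9 and 12 follow
    from g by the double and triple angle formulas, that at 10 from the value at 5. *)
Lemma twocos30 (z : algC) : 30.-primitive_root z -> let g := twocos (z ^+ 3) in
  [/\ g ^+ 2 = g + 1, twocos (z ^+ 5) = 1, twocos (z ^+ 6) = g - 1,
      twocos (z ^+ 9) = 1 - g & twocos (z ^+ 10) = -1 /\ twocos (z ^+ 12) = - g].
Proof.
move=> zp g; have z0 : z != 0 by apply: unity_neq0 (prim_expr_order zp).
have z15 : z ^+ 15 = -1 := prim_root_half (k := 15) zp.
have z6 : z ^+ 6 != 1 by rewrite -(prim_order_dvd zp).
have z10 : z ^+ 10 != 1 by rewrite -(prim_order_dvd zp).
have t5 : twocos (z ^+ 5) = 1.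
  have /eqP : (z ^+ 5 + 1) * (z ^+ 10 - z ^+ 5 + 1) = 0.
    by transitivity (z ^+ 15 + 1); [ring|rewrite z15 addNr].
  rewrite mulf_eq0 addr_eq0 => /orP[/eqP z5|/eqP e].
    by case/negP: z10; rewrite (exprM z 5 2) z5 sqrrN expr1n.
  apply/eqP; rewrite -subr_eq0 -(mulIr_eq0 _ (mulIf (expf_neq0 5 z0))); apply/eqP.
  by rewrite -[RHS]e /twocos; field.
have g2 : g ^+ 2 = g + 1.
  have /eqP : (z ^+ 3 + 1) * (z ^+ 12 - z ^+ 9 + z ^+ 6 - z ^+ 3 + 1) = 0.
    by transitivity (z ^+ 15 + 1); [ring|rewrite z15 addNr].
  rewrite mulf_eq0 addr_eq0 => /orP[/eqP z3|/eqP e].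
    by case/negP: z6; rewrite (exprM z 3 2) z3 sqrrN expr1n.
  apply/eqP; rewrite -subr_eq0 -(mulIr_eq0 _ (mulIf (expf_neq0 6 z0))); apply/eqP.
  by rewrite -[RHS]e /g /twocos; field.
have t6 : twocos (z ^+ 6) = g - 1.
  by rewrite (exprM z 3 2) twocosX2 ?expf_neq0 // -/g g2; ring.
have g3 : g ^+ 3 = g ^+ 2 * g by ring.
have g4 : (g - 1) ^+ 2 = g ^+ 2 - 2 * g + 1 by ring.
split=> //.
  by rewrite (exprM z 3 3) twocosX3 ?expf_neq0 // -/g g3 g2 mulrDl -expr2 g2; ring.
split; first by rewrite (exprM z 5 2) twocosX2 ?expf_neq0 // t5; ring.
by rewrite (exprM z 6 2) twocosX2 ?expf_neq0 // t6 g4 g2; ring.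
Qed.

(** * Necessity of the conditions, in the exponents p = a + b and q = a - b *)

Definition sum_free (m : nat) (p q c : int) : Prop :=
  forall z : algC, z ^+ m = 1 -> z != 1 ->
    twocos (z ^ p) + twocos (z ^ q) - twocos (z ^ c) != 2.

Lemma sum_freeC m p q c : sum_free m p q c -> sum_free m q p c.
Proof. by move=> H z zm z1; rewrite [X in X - _]addrC; exact: H. Qed.

(** For a common divisor d > 1, a primitive d-th root z has z^q = 1 and z^p equal to z^c or its
    inverse, so the sum is 2. *)
Lemma sum_free_coprime m p q c : (0 < m)%N -> sum_free m p q c ->
  coprimez m (gcdz q (p + c)) /\ coprimez m (gcdz q (p - c)).
Proof.
move=> m0 H.
have gen (x : int) : (forall z : algC, z != 0 -> z ^ x = 1 ->
    twocos (z ^ p) = twocos (z ^ c)) -> coprimez m (gcdz q x).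
  move=> Hx; apply/coprimez_gcdP => d dm dq dx.
  have d0 : (0 < d)%N := dvdn_gt0 m0 dm.
  have [z zp] := C_prim_root_exists d0.
  have z0 : z != 0 := unity_neq0 d0 (prim_expr_order zp).
  apply/eqP; rewrite -dvdn1 (prim_order_dvd zp) expr1; apply: contraT => z1.
  have /H/(_ z1) : z ^+ m = 1 by apply/eqP; rewrite -(prim_order_dvd zp).
  rewrite (Hx z z0); last by apply/eqP; rewrite (expz_eq1 _ zp).
  have -> : z ^ q = 1 by apply/eqP; rewrite (expz_eq1 _ zp).
  by rewrite twocos1 addrAC subrr add0r eqxx.
split; apply: gen => z z0; rewrite expfzDr // -?invr_expz => e; apply/eqP;
  rewrite twocos_eq ?expfz_neq0 //.
  by rewrite e eqxx orbT.
by rewrite -(inj_eq (mulIf (invr_neq0 (expfz_neq0 c z0)))) e divff ?expfz_neq0 // eqxx.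
Qed.

Lemma v2_double (x : int) : x != 0 -> v2 (2 * x) = (v2 x).+1.
Proof. by move=> x0; rewrite /v2 abszM lognM ?absz_gt0 // logn_prime. Qed.

(** Applied with x = a and x = b. If the valuations matched, a root z of order 2^(v2 c + 1) would
    have z^c = z^(2x) = -1; the terms at p and q would cancel, and that at c would contribute 2. *)
Lemma sum_free_v2 m p q c x : (0 < m)%N -> c != 0 -> x != 0 ->
  sum_free m p q c -> 2 * x = p + q \/ 2 * x = p - q ->
  (v2 c < v2 m%:Z)%N -> (v2 x)%:Z <> (v2 c)%:Z - 1.
Proof.
move=> m0 c0 x0 H xE cm xc.
have k0 : (0 < 2 ^ (v2 c).+1)%N by rewrite expn_gt0.
have [z zp] := C_prim_root_exists k0.
have z0 : z != 0 := unity_neq0 k0 (prim_expr_order zp).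
have zm : z ^+ m = 1.
  by apply/eqP; rewrite -(prim_order_dvd zp) pfactor_dvdn.
have z1 : z != 1.
  rewrite -[z]expr1 -(prim_order_dvd zp) dvdn1; apply/eqP => e.
  by have := expnSr 2 (v2 c); lia.
have zc : z ^ c = -1 by apply: expz_v2 zp _ _.
have zx : z ^ (2 * x) = -1.
  apply: expz_v2 zp _ _; first by lia.
  by rewrite v2_double //; lia.
case/eqP: (H z zm z1); rewrite zc twocosN twocos1 opprK.
suff -> : twocos (z ^ p) + twocos (z ^ q) = 0 by rewrite add0r.
have zq0 := expfz_neq0 q z0.
case: xE => xE.
  have -> : z ^ p = - (z ^ q)^-1.
    by rewrite invr_expz -[p](addrK q) -xE expfzDr // zx mulN1r.
  by rewrite twocosN twocosV addNr.
have -> : z ^ p = - z ^ q.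
  by rewrite -[p](subrK q) -xE expfzDr // zx mulN1r.
by rewrite twocosN addNr.
Qed.

Lemma sum_free12 m p q c : (12 %| m)%N -> sum_free m p q c ->
  ~ [/\ eqpm_mod 12 p 2, eqpm_mod 12 q 2 & eqpm_mod 12 c 3].
Proof.
have [z zp] := @C_prim_root_exists 12 isT.
move=> m12 H [p2 q2 c3]; have zm : z ^+ m = 1.
  by apply/eqP; rewrite -(prim_order_dvd zp).
have z1 : z != 1 by rewrite -[z]expr1 -(prim_order_dvd zp).
case/eqP: (H z zm z1); have [t2 t3] := twocos12 zp.
rewrite (twocos_eqpm zp p2) (twocos_eqpm zp q2) (twocos_eqpm zp c3).
rewrite -[z ^ 2]/(z ^+ 2) -[z ^ 3]/(z ^+ 3) t2 t3; ring.
Qed.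

Lemma sum_free30 m p q c : (30 %| m)%N -> sum_free m p q c ->
  [/\ ~ (one_other_mod 30 p q 3 5 /\ eqpm_mod 30 c 6),
      ~ (one_other_mod 30 p q 3 9 /\ eqpm_mod 30 c 10) &
      ~ (one_other_mod 30 p q 5 9 /\ eqpm_mod 30 c 12)].
Proof.
have [z zp] := @C_prim_root_exists 30 isT.
move=> m30 H; have zm : z ^+ m = 1 by apply/eqP; rewrite -(prim_order_dvd zp).
have z1 : z != 1 by rewrite -[z]expr1 -(prim_order_dvd zp).
have [g2 t5 t6 t9 [t10 t12]] := twocos30 zp.
split=> -[pq ck]; case/eqP: (H z zm z1);
  rewrite (twocos_one_other zp pq) (twocos_eqpm zp ck) -!exprnP.
- by rewrite t5 t6; ring.
- by rewrite t9 t10; ring.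
- by rewrite t5 t9 t12; ring.
Qed.

(** * Sufficiency of the conditions, and conclusion *)

Lemma sum_freeP m p q c : (0 < m)%N -> (2 %| p - q)%Z ->
  (forall (n : nat), (n %| m)%N -> (1 < n)%N ->
    [/\ ~ ((n %| p)%Z /\ ((n %| q - c)%Z \/ (n %| q + c)%Z)),
        ~ ((n %| q)%Z /\ ((n %| p - c)%Z \/ (n %| p + c)%Z)) &
        ~ [/\ (n %| 2 * c)%Z, ~~ (n %| c)%Z &
         ((n %| 2 * (p - q))%Z /\ ~~ (n %| p - q)%Z) \/
         ((n %| 2 * (p + q))%Z /\ ~~ (n %| p + q)%Z)]]) ->
  ((12 %| m)%N ->
    ~ [/\ eqpm_mod 12 p 2, eqpm_mod 12 q 2 & eqpm_mod 12 c 3]) ->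
  ((30 %| m)%N ->
    [/\ ~ (one_other_mod 30 p q 3 5 /\ eqpm_mod 30 c 6),
        ~ (one_other_mod 30 p q 3 9 /\ eqpm_mod 30 c 10) &
        ~ (one_other_mod 30 p q 5 9 /\ eqpm_mod 30 c 12)]) ->
  sum_free m p q c.
Proof.
move=> m0 par Hn H12 H30 x xm x1; apply/negP => /eqP rel.
have [n zp nm] := prim_order_exists m0 xm.
have n1 : (1 < n)%N.
  have := prim_order_gt0 zp; rewrite leq_eqVlt => /orP[/eqP n1|//].
  by move: zp x1; rewrite -n1 => /prim_expr_order; rewrite expr1 => ->; rewrite eqxx.
have [N1 N2 N3] := Hn n nm n1.
(* A common divisor d > 1 would itself violate the first clause of [Hn], as d | p and d | q - c. *)
have prim (d : nat) : (d %| n)%N -> (d %| p)%Z -> (d %| q)%Z -> (d %| c)%Z -> d = 1%N.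
  move=> dn dp dq dc; apply/eqP; case: eqP => // /eqP d1.
  have d0 := dvdn_gt0 (prim_order_gt0 zp) dn.
  have [D _ _] := Hn d (dvdn_trans dn nm) ltac:(lia).
  by case: D; split=> //; left; rewrite rpredB.
have prim' d dn dq dp dc := prim d dn dp dq dc.
have par' : (2 %| q - p)%Z by rewrite -opprB rpredN.
(* The exponent is doubled to accommodate the sign of [- x ^ c] when [m] is odd. *)
have x2m k : (x ^ k) ^+ (m * 2) = 1.
  by rewrite exprM -[(x ^ k) ^+ m]/((x ^ k) ^ m%:Z) exprzAC -[x ^ m]/(x ^+ m) xm
    exp1rz expr1n.
have x2mN k : (- x ^ k) ^+ (m * 2) = 1.
  by rewrite mulnC exprM sqrrN -exprM mulnC x2m.
have m20 : (0 < m * 2)%N by rewrite muln_gt0 m0.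
have rel' : twocos (x ^ p) + twocos (x ^ q) + twocos (- x ^ c) = 2.
  by rewrite twocosN.
have case_uvw p' q' : [/\ n = 30%N, eqpm_mod 30 p' 5 &
      (eqpm_mod 30 q' 3 /\ eqpm_mod 30 c 6) \/
      (eqpm_mod 30 q' 9 /\ eqpm_mod 30 c 12)] ->
      one_other_mod 30 p q =2 one_other_mod 30 p' q' -> False.
  move=> [n30 p5 qc] oo; rewrite n30 in nm.
  have [F1 _ F3] := H30 nm; move: F1 F3; rewrite !oo /one_other_mod p5.
  case: qc => -[q3 c6] F1 F3; [apply: F1|apply: F3]; rewrite q3 c6 ?orbT //.
case: (twocos_sum3 m20 (x2m p) (x2m q) (x2mN c) rel').
- case/(solution_exponent_p zp prim par) => [//|/case_uvw]; exact.
- case/(solution_exponent_p zp prim' par') => [//|/case_uvw]; apply=> k l.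
  by rewrite /one_other_mod orbC.
- case/(solution_exponent_c zp prim) => [//|[n12 F]|[n30 pq c10]].
    by apply: H12 F; rewrite -n12.
  by rewrite n30 in nm; have [_ F _] := H30 nm; apply: F.
Qed.

Theorem theorem4p1 (R : realFieldType) (m : nat) (a b c : int)
    (hm : (3 <= m)%N)
    (ha : 1 <= a) (hab : a <= b) (hb : 2 * b < m%:Z)
    (hc : 1 <= c) (hcm : 2 * c <= m%:Z) :
  is_nut_graph R (@B2 m a b c) <->
  [/\ [/\ coprimez m%:Z (gcdz (a - b) (a + b + c)),
          coprimez m%:Z (gcdz (a - b) (a + b - c)),
          coprimez m%:Z (gcdz (a + b) (a - b + c)) &
          coprimez m%:Z (gcdz (a + b) (a - b - c))],
      (* the equalities are between integers: the right-hand side may be -1 *)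
      ((v2 c < v2 m%:Z)%N ->
        (v2 a)%:Z <> (v2 c)%:Z - 1 /\ (v2 b)%:Z <> (v2 c)%:Z - 1),
      ((12 %| m)%N ->
        ~ [/\ eqpm_mod 12 (a + b) 2, eqpm_mod 12 (a - b) 2 &
              eqpm_mod 12 c 3]) &
      ((30 %| m)%N ->
        [/\ ~ (one_other_mod 30 (a + b) (a - b) 3 5 /\ eqpm_mod 30 c 6),
            ~ (one_other_mod 30 (a + b) (a - b) 3 9 /\ eqpm_mod 30 c 10) &
            ~ (one_other_mod 30 (a + b) (a - b) 5 9 /\ eqpm_mod 30 c 12)])].
Proof.
have m0 : (0 < m)%N by apply: leq_trans hm.
have c0 : c != 0 by lia.
have a0 : a != 0 by lia.
have b0 : b != 0 by lia.
rewrite nut_B2 // -/(sum_free m (a + b) (a - b) c); split=> [H|].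
  have [i1 i2] := sum_free_coprime m0 H.
  have [i3 i4] := sum_free_coprime m0 (sum_freeC H).
  split=> //.
  - move=> cm; split; apply: (sum_free_v2 m0 c0 _ H _ cm) => //.
      by left; ring.
    by right; ring.
  - by move=> m12; apply: sum_free12 H.
  - by move=> m30; apply: sum_free30 H.
case=> -[/coprimez_gcdP i1 /coprimez_gcdP i2 /coprimez_gcdP i3 /coprimez_gcdP i4].
move=> ii H12 H30; apply: sum_freeP => //.
  (* The exponents a + b and a - b have the same parity. *)
  by rewrite (_ : _ - _ = b * 2) ?dvdz_mull //; ring.
move=> n nm n1; split.
- by move=> [np [nq|nq]]; [have := i4 n nm np nq|have := i3 n nm np nq]; lia.
- by move=> [np [nq|nq]]; [have := i2 n nm np nq|have := i1 n nm np nq]; lia.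
move=> [n2c nc].
have -> : a + b - (a - b) = 2 * b by ring.
have -> : a + b + (a - b) = 2 * a by ring.
(* The same lemma applied to 2b or 2a gives v2 c + 1 = v2 b + 2 or v2 c + 1 = v2 a + 2, against
   condition (ii). *)
have nv := v2_half c0 n2c nc.
have cm : (v2 c < v2 m%:Z)%N by rewrite /v2 /= -nv dvdn_leq_log.
have [va vb] := ii cm.
have b20 : 2 * b != 0 by rewrite mulf_neq0.
have a20 : 2 * a != 0 by rewrite mulf_neq0.
by case=> -[n4 n2]; [apply: vb|apply: va]; move: nv;
  rewrite (v2_half _ n4 n2) ?v2_double //; clear; lia.
Qed.
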